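(* Let $\Omega \subset \mathbb{C}^n$ be a bounded domain. The following are equivalent: \begin{enumerate} \item $\Omega$ is P-hyperconvex; \item for every $z \in \partial \Omega$ and every $\mu \in \mathcal{J}_z(\overline{\Omega})$, one has $\operatorname{supp}(\mu) \subset \partial \Omega$; \item for every $z \in \partial \Omega$ there exists a function $\varphi \in \mathcal{PSH}(\overline{\Omega})$, $\varphi \not\equiv 0$, such that $\varphi \leq 0$ on $\overline{\Omega}$ and $\varphi(z)=0$; \item for every $z \in \overline{\Omega}$ there exists a neighborhood $V_z$ of $z$ such that $V_z \cap \Omega$ is P-hyperconvex. \end{enumerate}
   Context: A domain is a connected open set. Upper semicontinuous functions take values in $[-\infty,\infty)$. For an open set $U\subset\mathbb{C}^n$, $\mathcal{PSH}(U)$ is the set of (ordinary) plurisubharmonic functions on $U$. For a compact set $X\subset\mathbb{C}^n$: - $\mathcal{PSH}^o(X)$ is the set of functions $u$ on $X$ for which there exist an open set $U\supset X$ and a function $\tilde u$, plurisubharmonic and continuous on $U$, with $\tilde u|_X=u$. - For $z\in X$, the set $\mathcal{J}_z(X)$ of Jensen measures for $z$ is the set of all (regular Borel) probability measures $\mu$ on $X$ such that $u(z)\le\int u\,d\mu$ for all $u\in\mathcal{PSH}^o(X)$. - $\mathcal{PSH}(X)$, the set of plurisubharmonic functions on the compact set $X$, is the set of all upper semicontinuous functions $u$ on $X$ such that $u(z)\le\int u\,d\mu$ for every $z\in X$ and every $\mu\in\mathcal{J}_z(X)$. A bounded domain $D\subset\mathbb{C}^n$ is called P-hyperconvex if there is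 a non-constant function $\phi\in\mathcal{PSH}(\overline{D})\cap C(\overline{D})$ such that $\phi(z)=0$ for all $z\in\partial D$. $\operatorname{supp}(\mu)$ denotes the support of $\mu$. *)

(* Defs.v *)
From HB Require Import structures.
From mathcomp Require Import all_boot all_order all_algebra complex.
From mathcomp Require Import all_classical all_reals all_analysis.

Set Implicit Arguments.
Unset Strict Implicit.
Unset Printing Implicit Defensive.

Import Order.TTheory GRing.Theory Num.Theory.
Import numFieldNormedType.Exports.

Local Open Scope classical_set_scope.
Local Open Scope ring_scope.
Local Open Scope complex_scope.
Local Open Scope ereal_scope.

(* [R[i]] alone carries no topology; its regular module [R[i]^o] does, namely
   the one of the complex modulus. The norm on [Cn R n] is the sup norm. *)
Notation Cn R n := 'rV[R[i]^o]_n.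

Notation BorelCn R n := (g_sigma_algebraType (@open (Cn R n))).

(* Semicontinuity on [A] is relative to [A]: in the topology of [subspace A]
   the points outside [A] are isolated, so that only the restriction of [u] to
   [A] matters. *)
Definition usc_on (R : realType) (T : topologicalType) (A : set T)
    (u : T -> \bar R) : Prop :=
  (forall x, A x -> u x < +oo) /\
  lower_semicontinuous ((fun x => - u x) : subspace A -> \bar R).

(* Sub-mean value inequality on every closed disc contained in [W]. As [v] is
   bounded above on the circle, the integral exists in [[-oo, +oo[]. The
   function -oo is allowed. *)
Definition subharmonic (R : realType) (W : set R[i]^o)
    (v : R[i]^o -> \bar R) : Prop :=
  usc_on W v /\
  forall (a : R[i]^o) (r : R), (0 < r)%R ->
    (forall l : R[i]^o, (`|l - a| <= r%:C)%R -> W l) ->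
    v a <= ((2 * pi)^-1)%:E *
      \int[lebesgue_measure]_(t in `[0%R, (2 * pi)%R])
        v (a + r%:C * (cos t +i* sin t))%R.

Definition psh (R : realType) (n : nat) (U : set (Cn R n))
    (u : Cn R n -> \bar R) : Prop :=
  usc_on U u /\
  forall a b : Cn R n,
    subharmonic [set l : R[i]^o | U (a + l *: b)%R]
                (fun l => u (a + l *: b)%R).

(* Continuous functions are real-valued. Functions on a set [X] are
   represented by total functions of which only the restriction to [X] is
   used; this holds for all the notions below. *)
Definition psho (R : realType) (n : nat) (X : set (Cn R n))
    (u : Cn R n -> R) : Prop :=
  exists (U : set (Cn R n)) (v : Cn R n -> R),
    [/\ open U, X `<=` U, {within U, continuous v},
        psh U (EFin \o v) & forall x, X x -> v x = u x].

(* A Borel probability measure on [X] is represented by a Borel probability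
   measure on the whole space giving mass 1 to [X]; finite Borel measures on
   [Cn R n] are automatically regular. *)
Definition jensen (R : realType) (n : nat) (X : set (Cn R n)) (z : Cn R n) :
    set (probability (BorelCn R n) R) :=
  [set mu : probability (BorelCn R n) R | mu X = 1 /\
    forall u : Cn R n -> R, psho X u ->
      (u z)%:E <= \int[mu]_(x in X) (u x)%:E].

Definition psh_compact (R : realType) (n : nat) (X : set (Cn R n))
    (u : Cn R n -> \bar R) : Prop :=
  usc_on X u /\
  forall (z : Cn R n) (mu : probability (BorelCn R n) R),
    X z -> jensen X z mu -> u z <= \int[mu]_(x in X) u x.

Definition supp (R : realType) (n : nat)
    (mu : probability (BorelCn R n) R) : set (Cn R n) :=
  [set x | forall U : set (Cn R n), open U -> U x -> 0 < mu U].

Definition bdry (T : topologicalType) (A : set T) : set T :=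
  closure A `\` interior A.

Definition bounded_domain (R : realType) (n : nat) (D : set (Cn R n)) : Prop :=
  [/\ open D, connected D, D !=set0 & bounded_set D].

Definition P_hyperconvex (R : realType) (n : nat) (D : set (Cn R n)) : Prop :=
  bounded_domain D /\
  exists phi : Cn R n -> R,
    [/\ exists x y, [/\ closure D x, closure D y & phi x != phi y],
        psh_compact (closure D) (EFin \o phi),
        {within closure D, continuous phi}
      & forall z, bdry D z -> phi z = 0%R].

(* Main.v *)
From HB Require Import structures.
Require Import Defs.
From mathcomp Require Import all_boot all_order all_algebra complex finmap.
From mathcomp Require Import all_classical all_reals all_analysis measurable_realfun.
From mathcomp Require Import ring lra.
Import Order.TTheory GRing.Theory Num.Theory.
Import numFieldNormedType.Exports.

(** The statement that Jensen measures of boundary points live on the boundary is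
    the pivot: each of the other three is shown to be equivalent to it.

    A function which is plurisubharmonic on the closure, nonpositive, and zero at
    a boundary point [z] must vanish on the support of every Jensen measure for
    [z] ([jensen_supp_zero]). It cannot vanish inside the domain without being
    identically zero, because means over small circles are Jensen measures
    ([circle_jensen], [strong_maximum]). Hence barriers keep Jensen measures on
    the boundary ([barrier_supp_bdry]), and the defining function of a
    P-hyperconvex domain is a barrier at all boundary points
    ([P_hyperconvex_barrier]). Conversely, if the Jensen measures of boundary
    points live on the boundary, minus the indicator function of the domain is a
    barrier at all of them ([supp_bdry_barrier]).

    It remains to build a continuous defining function. Let [g] be continuous on
    the closure and zero on the boundary. Edwards' theorem ([edwards]) states
    that at each point the supremum of the minorants of [g] in [psho] equals
    the integral of [g] for some Jensen measure of that point; it follows from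
    the Hahn-Banach theorem, for the supremum is superlinear in [g], and from the
    Riesz representation theorem. On the boundary the supremum is therefore zero,
    and by compactness a single minorant exceeds [- e] on the whole boundary
    ([boundary_minorant]). When [g] is minus the distance to the complement,
    Walsh's argument applies: a minorant can be translated slightly and
    glued to that minorant ([glue_translate]), which yields the continuity of the
    supremum, a defining function ([jensen_supp_bdry_P_hyperconvex]).

    Finally, local P-hyperconvexity implies the pivot. The previous results,
    applied to the intersections with neighbourhoods of boundary points, give
    continuous plurisubharmonic bumps that are nearly 1 on the boundary and zero
    away from it ([local_bump]). Bumps of shrinking supports are added up until
    the sums are large on the boundary while sums that belong to different
    neighbourhoods differ by at most 2 ([bump_ladder]). After the addition of
    bounded quadratic terms their maximum is plurisubharmonic near the closure
    ([psho_glue_max]). The functions obtained are as large as desired on the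
    boundary, are never much larger elsewhere, and are bounded independently of
    that on a compact set inside the domain ([growing_functions]). A Jensen
    measure of a boundary point which charges this compact set would contradict
    the inequality which defines it ([local_P_hyperconvex_supp_bdry]). Here and
    throughout, maxima of local pieces are recognized as plurisubharmonic because
    for continuous functions the mean value inequality on small discs implies it
    on all discs ([cpsh_local]). *)

Set Implicit Arguments.
Unset Strict Implicit.
Unset Printing Implicit Defensive.

Local Open Scope classical_set_scope.
Local Open Scope ring_scope.

(** * The norm as a real number, and the unit circle *)

Section real_norm.
Variables (R : realType) (V : normedModType R[i]).
Implicit Types (x y : V) (l : R[i]).

(** The norm of a module over [R[i]] is itself a complex number; its real part is
    the norm in the usual sense. *)
Definition rnorm x : R := complex.Re `|x|.

Lemma rnormE x : `|x| = (rnorm x)%:C%C.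
Proof. by rewrite /rnorm RRe_real ?normr_real. Qed.

Lemma rnorm_ge0 x : 0 <= rnorm x.
Proof. by rewrite -lecR -rnormE; exact: normr_ge0. Qed.

Lemma rnorm0 : rnorm 0 = 0.
Proof. by rewrite /rnorm normr0. Qed.

Lemma rnorm_eq0 x : rnorm x = 0 -> x = 0.
Proof. by move=> x0; apply: normr0_eq0; rewrite rnormE x0. Qed.

Lemma rnormN x : rnorm (- x) = rnorm x.
Proof. by rewrite /rnorm normrN. Qed.

Lemma rdistC x y : rnorm (x - y) = rnorm (y - x).
Proof. by rewrite -rnormN opprB. Qed.

Lemma ler_rnormD x y : rnorm (x + y) <= rnorm x + rnorm y.
Proof. by rewrite -lecR rmorphD /= -!rnormE; exact: ler_normD. Qed.

Lemma ler_rdistD y x z : rnorm (x - z) <= rnorm (x - y) + rnorm (y - z).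
Proof. by rewrite -[x - z](subrKA y); exact: ler_rnormD. Qed.

Lemma rnormZ l x : rnorm (l *: x) = complex.Re `|l| * rnorm x.
Proof.
by apply: complexI; rewrite rmorphM /= -!rnormE normrZ; congr (_ * _).
Qed.

Lemma nbhs_rnormP x (A : set V) :
  nbhs x A <-> exists2 r : R, 0 < r & forall y, rnorm (y - x) < r -> A y.
Proof.
split=> [/nbhs_ballP[e /= e0 eA]|[r r0 rA]].
  have er : e = (complex.Re e)%:C%C by rewrite RRe_real ?gtr0_real.
  exists (complex.Re e); first by rewrite -ltcR -er.
  move=> y xy; apply: eA; rewrite -ball_normE /ball_ /= distrC rnormE er ltcR.
  exact: xy.
apply/nbhs_ballP; exists r%:C%C => /=; first by rewrite ltcR.
move=> y; rewrite -ball_normE /ball_ /= distrC rnormE ltcR; exact: rA.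
Qed.

Lemma nbhs_rball x (r : R) : 0 < r -> nbhs x [set y | rnorm (y - x) < r].
Proof. by move=> r0; apply/nbhs_rnormP; exists r. Qed.

Lemma rnorm_continuous : continuous rnorm.
Proof.
move=> x; apply/cvgrPdist_lt => e e0; near=> y.
have xy : rnorm (y - x) < e by near: y; exact: nbhs_rball.
rewrite ltr_distl; have := ler_rdistD y x 0; have := ler_rdistD x y 0.
rewrite !subr0 (rdistC x y); lra.
Unshelve. all: by end_near. Qed.

Lemma continuous_rnormP (f : V -> R) x : {for x, continuous f} <->
  forall e, 0 < e -> exists2 d, 0 < d & forall y, rnorm (y - x) < d ->
    `|f y - f x| < e.
Proof.
split=> [/cvgrPdist_lt fx e e0|fx].
  have /nbhs_rnormP[d d0 dP] := fx _ e0; exists d => // y /dP.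
  by rewrite distrC.
apply/cvgrPdist_lt => e /fx[d d0 dP]; apply/nbhs_rnormP; exists d => // y /dP.
by rewrite distrC.
Qed.

End real_norm.

Section complex_plane.
Variable R : realType.
Local Notation C := (R[i]^o).

Definition cis (t : R) : R[i] := (cos t +i* sin t)%C.

Lemma normc_rnorm (z : R[i]) : `|z| = (rnorm (z : C))%:C%C.
Proof. exact: (@rnormE R C z). Qed.

Lemma normc_re_im (z : R[i]) : complex.Re `|z| <= `|complex.Re z| + `|complex.Im z|.
Proof.
rewrite normc_def /= -(ger0_norm (addr_ge0 (normr_ge0 (complex.Re z)) (normr_ge0 (complex.Im z)))).
rewrite -sqrtr_sqr ler_sqrt ?sqr_ge0//.
rewrite sqrrD !real_normK ?num_real// -addrA lerD2l lerDr.
by rewrite mulrn_wge0// mulr_ge0.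
Qed.

Lemma norm_cis t : `|cis t| = 1.
Proof. by rewrite normc_def /= cos2Dsin2 sqrtr1. Qed.

Lemma cisD s t : cis (s + t) = cis s * cis t.
Proof.
rewrite /cis cosD sinD; apply/eqP; rewrite eq_complex /= eqxx /=.
by apply/eqP; ring.
Qed.

Lemma cis0 : cis 0 = 1.
Proof. by rewrite /cis cos0 sin0. Qed.

Lemma cis2pi : cis (2 * pi) = 1.
Proof. by rewrite /cis mulr_natl cos2pi sin2pi. Qed.

End complex_plane.

(** * Means over the unit circle *)

Section circle_mean.
Variable R : realType.
Local Notation mu := (@lebesgue_measure R).
Implicit Types (F G : R -> R).

Lemma twopi_gt0 : 0 < 2 * pi :> R.
Proof. by rewrite mulr_gt0 ?pi_gt0. Qed.

Definition cmean F : R := (2 * pi)^-1 * \int[mu]_(t in `[0, 2 * pi]) F t.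

Lemma continuous_integrable F (a b : R) : continuous F ->
  mu.-integrable `[a, b] (EFin \o F).
Proof.
move=> cF; apply: continuous_compact_integrable; first exact: segment_compact.
exact: continuous_subspaceT.
Qed.

Lemma cmeanD F G : continuous F -> continuous G ->
  cmean (fun t => F t + G t) = cmean F + cmean G.
Proof.
by move=> cF cG; rewrite /cmean RintegralD ?mulrDr//; exact: continuous_integrable.
Qed.

Lemma cmeanZ c F : continuous F -> cmean (fun t => c * F t) = c * cmean F.
Proof.
by move=> cF; rewrite /cmean RintegralZl 1?mulrCA//; exact: continuous_integrable.
Qed.

Lemma cmean_cst c : cmean (fun=> c) = c.
Proof.
rewrite /cmean Rintegral_cst//= lebesgue_measure_itv /= lte_fin twopi_gt0.
by rewrite -EFinD /= subr0 mulrCA mulVf ?mulr1// gt_eqF// twopi_gt0.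
Qed.

Lemma le_cmean F G : continuous F -> continuous G -> (forall t, F t <= G t) ->
  cmean F <= cmean G.
Proof.
move=> cF cG FG; rewrite /cmean ler_pM2l ?invr_gt0 ?twopi_gt0//.
by apply: le_Rintegral => //; exact: continuous_integrable.
Qed.

(** By continuity [F] stays below [c] by a fixed amount on an arc. *)
Lemma cmean_lt F c : continuous F -> (forall t, F t <= c) -> F 0 < c ->
  cmean F < c.
Proof.
move=> cF Fc F0.
pose e := (c - F 0) / 2; have e0 : 0 < e by rewrite divr_gt0 ?subr_gt0.
have /cvgrPdist_lt/(_ _ e0)/nbhs_ballP[d /= d0 dP] := cF 0.
pose r := Num.min (d / 2) pi.
have r0 : 0 < r by rewrite lt_min divr_gt0//= pi_gt0.
have rpi : r <= 2 * pi by rewrite (@le_trans _ _ pi) ?ge_min ?lexx ?orbT// ler_pMl ?pi_gt0// ler1n.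
have Fr t : 0 <= t <= r -> F t <= c - e.
  move=> /andP[t0 tr].
  have : `|F 0 - F t| < e.
    apply: dP; rewrite /ball /= sub0r normrN ger0_norm//.
    by rewrite (le_lt_trans tr)// gt_min ltr_pdivrMr// ltr_pMr// ltr1n.
  by rewrite ltr_distlC => /andP[_]; rewrite /e; lra.
have -> : cmean F = (2 * pi)^-1 *
    (\int[mu]_(t in `[0, r]) F t + \int[mu]_(t in `]r, (2 * pi)]) F t).
  have := @Rintegral_itvB _ F (BLeft 0) (BRight (2 * pi)) r.
  move=> /(_ (continuous_integrable _ _ cF)); rewrite !bnd_simp => /(_ (ltW r0) rpi) <-.
  by rewrite addrC subrK.
have I1 : \int[mu]_(t in `[0, r]) F t <= (c - e) * r.
  apply: (@le_trans _ _ (\int[mu]_(t in `[0, r]) (c - e))).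
    apply: le_Rintegral => //; first exact: continuous_integrable.
    by apply: continuous_integrable; exact: cst_continuous.
  by rewrite Rintegral_cst//= lebesgue_measure_itv /= lte_fin r0 -EFinD /= subr0.
have I2 : \int[mu]_(t in `]r, (2 * pi)]) F t <= c * (2 * pi - r).
  apply: (@le_trans _ _ (\int[mu]_(t in `]r, (2 * pi)]) c)).
    have sub : [set` `]r, (2 * pi)]] `<=` [set` `[r, 2 * pi]] by exact: subset_itv_oc_cc.
    apply: le_Rintegral => //.
      exact: (@integrableS _ _ _ mu `[r, 2 * pi] _ _ _ _ sub (continuous_integrable _ _ cF)).
    apply: (@integrableS _ _ _ mu `[r, 2 * pi] _ _ _ _ sub) => //.
    by apply: continuous_integrable; exact: cst_continuous.
  rewrite Rintegral_cst//= lebesgue_measure_itv /= lte_fin -EFinD.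
  case: ltP => //= rp; have -> : 2 * pi = r by apply/le_anti; rewrite rpi rp.
  by rewrite subrr.
rewrite mulrC ltr_pdivrMr ?twopi_gt0//.
have er : 0 < e * r by rewrite mulr_gt0.
move: I1 I2 er; nra.
Qed.

(** The integrand is the derivative of a periodic function. *)
Lemma cmean_trig a b : cmean (fun t => a * cos t + b * sin t) = 0.
Proof.
have cc : continuous (@cos R) by exact: continuous_cos.
have cs : continuous (@sin R) by exact: continuous_sin.
have csZ c (f : R -> R) : continuous f -> continuous (fun t => c * f t).
  by move=> cf x; apply: cvgM; [exact: cvg_cst|exact: cf].
rewrite cmeanD ?cmeanZ//; try exact: csZ.
have H (f g : R -> R) : continuous g -> (forall x : R, is_derive x (1 : R) (f : R -> R) (g x)) ->
    f (2 * pi) = f 0 -> cmean g = 0.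
  move=> cg df ff; rewrite /cmean /Rintegral (@continuous_FTC2 _ _ f).
  - by rewrite -EFinB ff subrr mulr0.
  - exact: twopi_gt0.
  - exact: continuous_subspaceT.
  - have cf : continuous f.
      move=> x; apply: differentiable_continuous; apply/derivable1_diffP.
      exact: ex_derive.
    split=> //.
    + by apply: cvg_at_right_filter; exact: cf.
    + by apply: cvg_at_left_filter; exact: cf.
  - by move=> x _; rewrite derive1E derive_val.
have -> : cmean (@cos R) = 0.
  by apply: (H (@sin R)) => //; rewrite mulr_natl sin2pi sin0.
have -> : cmean (@sin R) = 0.
  apply: (H (fun x => - cos x)) => [//||]; last by rewrite mulr_natl cos2pi cos0.
  by move=> x; apply: is_derive_eq; rewrite opprK.
by rewrite !mulr0 addr0.
Qed.

Lemma continuous_unif F (a b e : R) : continuous F -> 0 < e ->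
  exists2 d : R, 0 < d & forall x y, a <= x <= b -> `|y - x| < d -> `|F y - F x| < e.
Proof.
move=> cF e0.
have /compact_near_coveringP cab := @segment_compact R a b.
have [|d /= d0 dP] := cab _ (0^'+) (fun d x => forall y, `|y - x| < d -> `|F y - F x| < e) _.
  move=> x _; have e20 : 0 < e / 2 by rewrite divr_gt0.
  have /cvgrPdist_lt/(_ _ e20)/nbhs_ballP[r /= r0 rP] := cF x.
  have r20 : 0 < r / 2 by rewrite divr_gt0.
  exists (ball x (r / 2), [set d | d < r / 2]); first split => /=.
  - exact: nbhsx_ballx.
  - exact: nbhs_right_lt.
  move=> [x' d] /= [xx' dr] y yx'.
  have h1 : `|F x - F x'| < e / 2.
    by apply: rP; apply: le_ball xx'; lra.
  have h2 : `|F x - F y| < e / 2.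
    apply: rP; rewrite /ball /=; move: xx'; rewrite /ball /= => xx'.
    rewrite -[x - y](subrKA x') (le_lt_trans (ler_normD _ _))//.
    by rewrite (distrC x' y); lra.
  rewrite -[F y - F x'](subrKA (F x)) (le_lt_trans (ler_normD _ _))//.
  by rewrite (distrC (F y)); lra.
exists (d / 2); first by rewrite divr_gt0.
have d2d : d / 2 < d by rewrite ltr_pdivrMr// ltr_pMr// ltr1n.
move=> x y xab yx; apply: (dP (d / 2)) => //=; rewrite ?divr_gt0//.
by rewrite sub0r normrN gtr0_norm// divr_gt0.
Qed.

Definition cavg N F s : R :=
  N%:R^-1 * \sum_(k < N) F (s + k%:R * (2 * pi / N%:R)).

Lemma cavg_shift N F s : (0 < N)%N -> (forall t, F (t + 2 * pi) = F t) ->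
  cavg N F (s + 2 * pi / N%:R) = cavg N F s.
Proof.
case: N => // N _ per; rewrite /cavg; congr (_ * _).
rewrite big_ord_recr big_ord_recl /= addrC; congr (_ + _).
  rewrite mul0r addr0 -(per s); congr F; rewrite -addrA; congr (_ + _).
  rewrite -{1}[2 * pi / _]mul1r -mulrDl -(natrD _ 1) add1n.
  by rewrite mulrCA mulfV ?mulr1// pnatr_eq0.
apply: eq_bigr => k _; congr F; rewrite -addrA; congr (_ + _).
by rewrite -{1}[2 * pi / _]mul1r -mulrDl -(natrD _ 1).
Qed.

(** Along equidistributed nodes the averages of a continuous periodic function
    tend to its mean, uniformly in the position of the first node. *)
Lemma cavg_le_cmean F (e : R) : continuous F -> (forall t, F (t + 2 * pi) = F t) ->
  0 < e -> exists2 N : nat, (0 < N)%N & forall s : R, cavg N F s <= cmean F + e.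
Proof.
move=> cF per e0; have [d d0 dP] := continuous_unif 0 (2 * pi) cF e0.
have [N N0 Nd] : exists2 N : nat, (0 < N)%N & 2 * pi / N%:R < d.
  exists (Num.truncn (2 * pi / d)).+1 => //.
  have := truncnS_gt (2 * pi / d); rewrite ltr_pdivrMr// => h.
  by rewrite ltr_pdivrMr ?ltr0n// [d * _]mulrC.
exists N => // s; pose h : R := 2 * pi / N%:R.
have h0 : 0 < h by rewrite divr_gt0 ?twopi_gt0 ?ltr0n.
have hN : h * N%:R = 2 * pi by rewrite /h divfK// pnatr_eq0 -lt0n.
have shiftm m t : cavg N F (t + m%:R * h) = cavg N F t.
  elim: m => [|m IH]; first by rewrite mul0r addr0.
  by rewrite -addn1 natrD mulrDl mul1r addrA cavg_shift.
(* A rotation by [h] permutes the nodes, so that [s] matters modulo [h] only. *)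
wlog s0h : s / 0 <= s <= h => [wl|].
  pose z := Num.floor (s / h); pose s' := s - z%:~R * h.
  have s'h : 0 <= s' <= h.
    have := floor_itv (s / h); rewrite -/z => /andP[].
    rewrite ler_pdivlMr// ltr_pdivrMr// intrD mulrDl mul1r /s' => z1 z2.
    by apply/andP; split; lra.
  suff -> : cavg N F s = cavg N F s' by exact: wl.
  have : s = s' + z%:~R * h by rewrite subrK.
  case: z @s' s'h => m s' s'h ss'; first by rewrite ss' shiftm.
  have -> : s' = s + m.+1%:R * h by rewrite /s' NegzE mulrNz mulNr opprK.
  by rewrite shiftm.
(* The left Riemann sums, with nodes [s + k h] in the intervals from [k h] to
   [(k + 1) h], are compared with the integral interval by interval. *)
have key m : (m <= N)%N -> h * \sum_(k < m) F (s + k%:R * h) <=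
    \int[mu]_(t in `[0, m%:R * h]) F t + m%:R * h * e.
  elim: m => [_|m IH mN].
    by rewrite big_ord0 mulr0 mul0r set_itv1 Rintegral_set1 mul0r addr0.
  rewrite big_ord_recr /= mulrDr.
  have mh0 : 0 <= m%:R * h by rewrite mulr_ge0 ?ler0n// ltW.
  have mh1 : m%:R * h < m.+1%:R * h by rewrite ltr_pM2r// ltr_nat.
  have step : h * F (s + m%:R * h) - h * e <= \int[mu]_(t in `](m%:R * h), (m.+1%:R * h)]) F t.
    have -> : h * F (s + m%:R * h) - h * e =
        \int[mu]_(t in `](m%:R * h), (m.+1%:R * h)]) (F (s + m%:R * h) - e).
      rewrite Rintegral_cst//= lebesgue_measure_itv /= lte_fin mh1 -EFinB /=.
      by rewrite -addn1 natrD; ring.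
    have sub : [set` `](m%:R * h), (m.+1%:R * h)]] `<=` [set` `[m%:R * h, m.+1%:R * h]].
      exact: subset_itv_oc_cc.
    apply: le_Rintegral => //.
    - apply: (@integrableS _ _ _ mu `[m%:R * h, m.+1%:R * h] _ _ _ _ sub) => //.
      by apply: continuous_integrable; exact: cst_continuous.
    - apply: (@integrableS _ _ _ mu `[m%:R * h, m.+1%:R * h] _ _ _ _ sub) => //.
      exact: continuous_integrable.
    move=> t /=; rewrite in_itv /= => /andP[t1 t2].
    have : `|F (s + m%:R * h) - F t| < e.
      apply: dP.
        rewrite (le_trans mh0 (ltW t1))/= (le_trans t2)//.
        by rewrite -hN mulrC ler_pM2l// ler_nat.
      move: t2; rewrite -addn1 natrD mulrDl mul1r => t2.
      rewrite (le_lt_trans _ Nd)// -/h ler_distl; case/andP: s0h; lra.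
    by rewrite ltr_distl => /andP[_]; lra.
  have := IH (ltnW mN).
  have := @Rintegral_itvB _ F (BLeft 0) (BRight (m.+1%:R * h)) (m%:R * h).
  move=> /(_ (continuous_integrable _ _ cF)); rewrite !bnd_simp => /(_ mh0 (ltW mh1)).
  have -> : m.+1%:R * h * e = m%:R * h * e + h * e by rewrite -addn1 natrD; ring.
  move: step; lra.
have := key N (leqnn N); rewrite [N%:R * h]mulrC hN => kN.
have p0 : 0 < 2 * pi :> R by exact: twopi_gt0.
rewrite -(ler_pM2l p0) [leRHS]mulrDr /cmean mulVKf ?gt_eqF//.
by rewrite /cavg mulrA; exact: kN.
Qed.

End circle_mean.

(** * Semicontinuity relative to a set *)
Section semicontinuity.
Variables (R : realType) (T : topologicalType).
Implicit Types (A : set T) (u : T -> \bar R) (f : T -> R).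

Lemma within_continuousP A f : {within A, continuous f} <->
  forall x, A x -> forall e, 0 < e -> \forall y \near x, A y -> `|f y - f x| < e.
Proof.
rewrite subspace_continuousP; split=> cf x Ax.
  move=> e e0; have /cvgrPdist_lt/(_ _ e0) := cf x Ax; rewrite near_withinE.
  by apply: filterS => y fy Ay; rewrite distrC fy.
apply/cvgrPdist_lt => e e0; rewrite near_withinE.
by apply: filterS (cf x Ax e e0) => y fy Ay; rewrite distrC fy.
Qed.

Lemma usc_on_lt_open A u (a : R) : usc_on A u ->
  exists2 O, open O & forall x, A x -> (O x <-> (u x < a%:E)%E).
Proof.
move=> [_ /lower_semicontinuousP/(_ (- a)%R)/open_subspaceP[W oW OA]].
exists W => // x Ax; have : (W `&` A) x <-> ((- u x > (- a)%:E)%E /\ A x).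
  by rewrite OA.
rewrite EFinN lteN2 => -[h1 h2]; split=> [Wx|ua]; first by case: h1.
by case: h2.
Qed.

Lemma usc_on_continuous A f : {within A, continuous f} -> usc_on A (EFin \o f).
Proof.
move=> cf; split=> [x _|]; first exact: ltry.
apply/lower_semicontinuousP => a.
have -> : [set x | ((- (f x)%:E) > a%:E)%E] = f @^-1` [set r | r < - a].
  by apply/seteqP; split => x /=; rewrite lte_fin ltrNr.
by move/continuousP : cf; apply; exact: open_lt.
Qed.

Lemma continuous_lt_open A f (a : R) : {within A, continuous f} ->
  exists2 O, open O & forall x, A x -> (O x <-> f x < a).
Proof.
move=> /usc_on_continuous/(usc_on_lt_open a)[W oW Of].
by exists W => // x /Of; rewrite lte_fin.
Qed.

Lemma continuous_gt_open A f (a : R) : {within A, continuous f} ->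
  exists2 O, open O & forall x, A x -> (O x <-> a < f x).
Proof.
move=> cf; have cNf : {within A, continuous (fun x => - f x)}.
  by move=> x; apply: continuousN; exact: cf.
have [W oW Of] := continuous_lt_open (- a) cNf.
by exists W => // x /Of; rewrite ltrN2.
Qed.

End semicontinuity.

(** * Continuous plurisubharmonic functions *)
Section continuous_psh.
Variables (R : realType) (n : nat).
Local Notation T := (Cn R n).
Local Notation C := (R[i]^o).
Local Notation mu := (@lebesgue_measure R).
Implicit Types (U : set T) (v w : T -> R) (p b x y : T).

(** Discs are given by their centre [p] and one of their radii [b], a vector of
    the complex line which contains them. *)
Definition in_disc U p b := forall l : R[i], `|l| <= 1 -> U (p + l *: b).

(** Plurisubharmonicity of a continuous real-valued function, for which means
    over circles are real numbers. *)
Definition cpsh U v := [/\ open U, forall x, U x -> {for x, continuous v}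
  & forall p b, in_disc U p b -> v p <= cmean (fun t => v (p + cis t *: b))].

Lemma line_continuous (V : normedModType R[i]) (a b : V) :
  continuous (fun l : C => a + l *: b).
Proof.
move=> l A /nbhs_rnormP[r r0 rA].
have b0 : 0 < rnorm b + 1 by rewrite ltr_wpDl// rnorm_ge0.
apply/nbhs_rnormP; exists (r / (rnorm b + 1)); first by rewrite divr_gt0.
move=> k kl; apply: rA; rewrite opprD addrACA subrr add0r -scalerBl rnormZ.
rewrite -/(rnorm (k - l : C)) (@le_lt_trans _ _ (rnorm (k - l : C) * (rnorm b + 1)))//.
  by rewrite ler_wpM2l ?rnorm_ge0// lerDl.
by rewrite -ltr_pdivlMr.
Qed.

Lemma cis_continuous : continuous (fun t : R => cis t : C).
Proof.
move=> t A /nbhs_rnormP[r r0 rA].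
have r20 : 0 < r / 2 by rewrite divr_gt0.
have /cvgrPdist_lt/(_ _ r20) := @continuous_cos R t.
have /cvgrPdist_lt/(_ _ r20) := @continuous_sin R t.
move=> hs hc; rewrite /= nbhs_filterE; suff : \forall s \near t, A (cis s) by [].
near=> s; apply: rA; rewrite /rnorm.
apply: le_lt_trans (normc_re_im _) _ => /=.
have : `|sin t - sin s| < r / 2 by near: s.
have : `|cos t - cos s| < r / 2 by near: s.
rewrite (distrC (cos t)) (distrC (sin t)); lra.
Unshelve. all: by end_near. Qed.

Lemma circle_continuous (V : normedModType R[i]) (p b : V) :
  continuous (fun t : R => p + cis t *: b).
Proof.
move=> t; apply: (@continuous_comp _ _ _ (fun t : R => cis t : C)
  (fun l : C => p + l *: b)); [exact: cis_continuous|exact: line_continuous].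
Qed.

Lemma in_disc_cis U p b t : in_disc U p b -> U (p + cis t *: b).
Proof. by apply; rewrite norm_cis. Qed.

Lemma circle_comp_continuous U v p b :
  (forall x, U x -> {for x, continuous v}) -> in_disc U p b ->
  continuous (fun t : R => v (p + cis t *: b)).
Proof.
move=> cv dU t; apply: (@continuous_comp _ _ _ (fun t : R => p + cis t *: b) v).
  exact: (@circle_continuous T).
by apply: cv; exact: in_disc_cis.
Qed.

Lemma cmeanE F : continuous F -> (cmean F)%:E =
  (((2 * pi)^-1)%:E * \int[mu]_(t in `[0%R, (2 * pi)%R]) (F t)%:E)%E.
Proof.
move=> cF; rewrite /cmean EFinM; congr (_ * _)%E; rewrite /Rintegral fineK//.
by apply: integrable_fin_num => //; exact: continuous_integrable.
Qed.

Lemma le_eq_integral (k : \bar R) (D : set R) (f g : R -> \bar R) : f =1 g ->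
  (k * \int[mu]_(t in D) f t <= k * \int[mu]_(t in D) g t)%E.
Proof. by move=> /funext ->. Qed.

(** The disc of centre [a0] and radius [r] in the complex line [a + l *: b] is the
    disc of centre [a + a0 *: b] and radius vector [r *: b]. *)
Lemma cpshP U v : open U ->
  {within U, continuous v} /\ psh U (EFin \o v) <-> cpsh U v.
Proof.
move=> oU; split=> [[cv [_ sh]]|[_ cv sh]].
  have {}cv x : U x -> {for x, continuous v}.
    by move: cv; rewrite continuous_open_subspace// => cv Ux; apply: cv; exact/mem_set.
  split=> // p b dU; rewrite -lee_fin cmeanE; last exact: circle_comp_continuous dU.
  have [_ /(_ 0 1 ltr01)] := sh p b.
  rewrite scale0r addr0 => /(_ _)/le_trans; apply.
    by move=> l; rewrite subr0 => l1; exact: dU.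
  by apply: le_eq_integral => t /=; rewrite add0r mul1r.
have cvU : {within U, continuous v}.
  by rewrite continuous_open_subspace// => x /set_mem; exact: cv.
split=> //; split; first exact: usc_on_continuous.
move=> a b; split.
  apply: (@usc_on_continuous R C _ (fun l => v (a + l *: b))).
  apply: continuous_in_subspaceT => l /set_mem /= Ul.
  apply: (@continuous_comp _ _ _ (fun l : C => a + l *: b) v).
    exact: line_continuous.
  exact: cv.
move=> a0 r r0 W.
have dU : in_disc U (a + a0 *: b) (r%:C%C *: b).
  move=> l l1; rewrite scalerA -addrA -scalerDl; apply: W.
  have rC0 : 0 < r%:C%C by rewrite ltcR.
  by rewrite addrC addKr normrM (gtr0_norm rC0) ger_pMl.
have := sh _ _ dU; rewrite -lee_fin cmeanE; last exact: circle_comp_continuous dU.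
move=> /le_trans; apply; apply: le_eq_integral => t /=.
by rewrite scalerA -addrA -scalerDl [_ * r%:C%C]mulrC.
Qed.

Lemma pshoP (X : set T) u :
  psho X u <-> exists U v, [/\ cpsh U v, X `<=` U & forall x, X x -> v x = u x].
Proof.
split=> [[U [v [oU XU cv pv vu]]]|[U [v [pv XU vu]]]].
  by exists U, v; split=> //; exact/cpshP.
have [oU _ _] := pv; have [cv psv] := (cpshP v oU).2 pv.
by exists U, v; split.
Qed.

End continuous_psh.

(** * Compactness in the complex space *)
Section heine_borel.
Variable R : realType.
Local Notation C := (R[i]^o).

Lemma continuous_rnormD (V W : normedModType R[i]) (f : V -> W) :
  (forall x y, rnorm (f x - f y) <= rnorm (x - y)) -> continuous f.
Proof.
move=> fl x A /nbhs_rnormP[r r0 rA]; apply/nbhs_rnormP; exists r => // y yx.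
by apply: rA; exact: le_lt_trans yx.
Qed.

Lemma closed_rball (V : normedModType R[i]) (x : V) (r : R) :
  closed [set y | rnorm (y - x) <= r].
Proof.
have c : continuous (fun y => rnorm (y - x)).
  move=> y; apply: (@continuous_comp _ _ _ (fun y : V => y - x) (@rnorm R V)).
    by apply: continuous_rnormD => u v; rewrite opprB addrA subrK.
  exact: rnorm_continuous.
have := (closed_comp (fun y _ => c y) (@closed_le R r)).
exact.
Qed.

Lemma compact_disc (M : R) : compact [set z : C | rnorm z <= M].
Proof.
pose f (u : R * R) : C := (u.1 +i* u.2)%C.
pose S : set (R * R) := `[- M, M]%classic `*` `[- M, M]%classic.
have cS : compact S by apply: compact_setX; exact: segment_compact.
have cf : continuous f.
  move=> [a b] A /nbhs_rnormP[r r0 rA].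
  have r20 : 0 < r / 2 by rewrite divr_gt0.
  exists (ball a (r / 2), ball b (r / 2)).
    by split; exact: nbhsx_ballx.
  move=> [c d] [/= ac bd]; apply: rA; rewrite /rnorm.
  apply: le_lt_trans (normc_re_im _) _ => /=.
  move: ac bd; rewrite /ball /= (distrC a) (distrC b); lra.
apply: (@subclosed_compact _ _ (f @` S)).
- by have := @closed_rball C 0 M; under eq_set do rewrite subr0.
- by apply: continuous_compact => //; exact: continuous_subspaceT.
move=> z /= zM; exists (complex.Re z, complex.Im z); last by case: z {zM}.
have : `|complex.Re z| <= M /\ `|complex.Im z| <= M.
  move: zM; rewrite /rnorm normc_def /= => zM.
  split; apply: le_trans zM; rewrite -sqrtr_sqr ler_sqrt ?addr_ge0 ?sqr_ge0//.
    by rewrite lerDl sqr_ge0.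
  by rewrite lerDr sqr_ge0.
by rewrite !ler_norml => -[h1 h2]; split; rewrite /= in_itv.
Qed.

Lemma rnorm_coord n (x : Cn R n) i : rnorm (x ord0 i : C) <= rnorm x.
Proof.
rewrite -lecR -!rnormE [leRHS]/Num.norm /= /mx_norm.
rewrite -[leLHS]nngE num_le.
exact: (@le_bigmax _ _ _ _ (fun i : 'I_1 * 'I_n => `|x i.1 i.2|%:nng) (ord0, i)).
Qed.

Lemma bounded_closed_compact_Cn n (A : set (Cn R n)) (M : R) :
  closed A -> (forall x, A x -> rnorm x <= M) -> compact A.
Proof.
move=> cA AM; apply: (subclosed_compact cA (@rV_compact C n _ (fun=> @compact_disc M))).
by move=> x /AM xM i; apply: le_trans xM; exact: rnorm_coord.
Qed.

End heine_borel.

(** * Operations on plurisubharmonic functions *)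
Section psh_closure.
Variables (R : realType) (n : nat).
Local Notation T := (Cn R n).
Local Notation C := (R[i]^o).
Implicit Types (U V G X : set T) (v w : T -> R) (p b x y h : T).

Lemma in_disc_sub U V p b : U `<=` V -> in_disc U p b -> in_disc V p b.
Proof. by move=> UV Up l l1; apply/UV/Up. Qed.

Lemma in_disc_center U p b : in_disc U p b -> U p.
Proof. by move=> /(_ 0); rewrite scale0r addr0 normr0; apply. Qed.

Lemma cpsh_sub U V v : open V -> V `<=` U -> cpsh U v -> cpsh V v.
Proof.
move=> oV VU [_ cv sv]; split=> // [x /VU/cv//|p b dV].
by apply: sv; exact: in_disc_sub dV.
Qed.

Lemma cpsh_cst U c : open U -> cpsh U (fun=> c).
Proof. by move=> oU; split=> // [x _|p b _]; [exact: cst_continuous|rewrite cmean_cst]. Qed.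

Lemma cpsh_add U v w : cpsh U v -> cpsh U w -> cpsh U (fun x => v x + w x).
Proof.
move=> [oU cv sv] [_ cw sw]; split=> // [x Ux|p b dU].
  exact: (continuousD (cv x Ux) (cw x Ux)).
by rewrite cmeanD ?lerD ?sv ?sw//; exact: circle_comp_continuous dU.
Qed.

Lemma cpsh_scale U v c : 0 <= c -> cpsh U v -> cpsh U (fun x => c * v x).
Proof.
move=> c0 [oU cv sv]; split=> // [x Ux|p b dU].
  have cc : {for x, continuous (fun _ : T => c)} by exact: cst_continuous.
  exact: (continuousM cc (cv x Ux)).
by rewrite cmeanZ ?ler_wpM2l ?sv//; exact: circle_comp_continuous dU.
Qed.

Lemma cpsh_max U v w : cpsh U v -> cpsh U w -> cpsh U (fun x => Num.max (v x) (w x)).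
Proof.
move=> [oU cv sv] [_ cw sw].
have cm x : U x -> {for x, continuous (fun x => Num.max (v x) (w x))}.
  by move=> Ux; exact: (continuous_max (cv x Ux) (cw x Ux)).
split=> // p b dU; rewrite ge_max; apply/andP; split.
  apply: le_trans (sv _ _ dU) _; apply: le_cmean => [||t].
  - exact: circle_comp_continuous dU.
  - exact: (circle_comp_continuous cm dU).
  - by rewrite le_max lexx.
apply: le_trans (sw _ _ dU) _; apply: le_cmean => [||t].
- exact: circle_comp_continuous dU.
- exact: (circle_comp_continuous cm dU).
- by rewrite le_max lexx orbT.
Qed.

Lemma cpsh_translate U v h : cpsh U v ->
  cpsh [set x | U (x + h)] (fun x => v (x + h)).
Proof.
have ch : continuous (fun x => x + h).
  by apply: continuous_rnormD => x y; rewrite opprD addrACA subrr addr0.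
move=> [oU cv sv]; split=> [|x Ux|p b dU].
- by move/continuousP: ch; exact.
- by apply: (@continuous_comp _ _ _ (fun x => x + h) v); [exact: ch|exact: (cv _ Ux)].
have := sv (p + h) b; under eq_fun do rewrite -addrA [h + _]addrC addrA.
by apply=> l l1; rewrite -addrA [h + _]addrC addrA; exact: dU.
Qed.

Lemma continuous_sum_for (S : topologicalType) N (f : 'I_N -> S -> R) (s : S) :
  (forall k, {for s, continuous (f k)}) ->
  {for s, continuous (fun t => \sum_k f k t)}.
Proof.
rewrite /prop_for; elim: N f => [|N IH] f cf.
  have -> : (fun t => \sum_k f k t) = (fun=> 0) :> (S -> R).
    by apply/funext => t; rewrite big_ord0.
  exact: cst_continuous.
have -> : (fun t => \sum_k f k t) =
    (fun t => f ord0 t + \sum_k f (lift ord0 k) t) :> (S -> R).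
  by apply/funext => t; rewrite big_ord_recl.
exact: (continuousD (cf ord0) (IH _ (fun k => cf (lift ord0 k)))).
Qed.

Lemma cmean_sum N (f : 'I_N -> R -> R) : (forall k, continuous (f k)) ->
  cmean (fun t => \sum_k f k t) = \sum_k cmean (f k).
Proof.
elim: N f => [|N IH] f cf.
  by under eq_fun do rewrite big_ord0; rewrite big_ord0 cmean_cst.
under eq_fun do rewrite big_ord_recl.
rewrite big_ord_recl cmeanD ?IH// => t.
by apply: continuous_sum_for => k; exact: cf.
Qed.

End psh_closure.

(** * Plurisubharmonicity is a local property *)

Section polar.
Variable R : realType.

Lemma unit_cis (z : R[i]) : `|z| = 1 -> exists s, z = cis s.
Proof.
case: z => x y; rewrite normc_def /= => /(congr1 (@complex.Re R)) /= xy1.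
have xy : x ^+ 2 + y ^+ 2 = 1.
  by rewrite -[LHS]sqr_sqrtr ?xy1 ?expr1n// addr_ge0 ?sqr_ge0.
have x1 : -1 <= x <= 1.
  by rewrite -ler_norml -(@ler_sqr _ `|x|) ?nnegrE// real_normK ?num_real// expr1n -xy lerDl sqr_ge0.
have cx : cos (acos x) = x by rewrite acosK// in_itv.
have sx : sin (acos x) = `|y|.
  by rewrite sin_acos// -xy addrC addKr sqrtr_sqr.
have [y0|y0] := leP 0 y.
  by exists (acos x); rewrite /cis cx sx ger0_norm.
by exists (- acos x); rewrite /cis cosN sinN cx sx ltr0_norm// opprK.
Qed.

End polar.

Section locality.
Variables (R : realType) (n : nat).
Local Notation T := (Cn R n).
Local Notation C := (R[i]^o).
Implicit Types (U V G X : set T) (v w : T -> R) (p b x y h : T).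

(** The mean value inequality on small discs implies it on all discs. The disc
    is averaged over the rotations of order [N]: the averaged function [w]
    still satisfies the inequality on small discs, hence attains its maximum
    over the closed disc on the boundary circle. There its values are the
    averages of [v] over [N] equidistributed points, which tend to the circle
    mean. *)
Lemma cpsh_local U v : open U ->
  (forall x, U x -> exists G w,
     [/\ G x, cpsh G w & forall y, G y -> v y = w y]) ->
  cpsh U v.
Proof.
move=> oU loc.
have cv x : U x -> {for x, continuous v}.
  move=> Ux; have [G [w [Gx [oG cw _] vw]]] := loc x Ux.
  apply/(@continuous_rnormP R T) => e e0.
  have [d d0 dP] := (@continuous_rnormP R T w x).1 (cw x Gx) e e0.
  have /(@nbhs_rnormP R T)[r r0 rG] := open_nbhs_nbhs (conj oG Gx).
  exists (Num.min d r) => [|y]; first by rewrite lt_min d0.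
  by rewrite lt_min => /andP[yd yr]; rewrite !vw ?dP//; exact: rG.
split=> // p b dU; apply/ler_addgt0Pr => e e0.
pose F t : R := v (p + cis t *: b).
have cF : continuous F by exact: circle_comp_continuous dU.
have per t : F (t + 2 * pi) = F t by rewrite /F cisD cis2pi mulr1.
have [N N0 NP] := cavg_le_cmean cF per e0.
pose h : R := 2 * pi / N%:R.
pose w (x : C) : R := N%:R^-1 * \sum_(k < N) v (p + (cis (k%:R * h) * x) *: b).
have wcis s : w (cis s) = cavg N F s.
  have E (k : 'I_N) : v (p + (cis (k%:R * h) * cis s) *: b) = F (s + k%:R * h).
    by rewrite /F cisD [cis s * _]mulrC.
  by rewrite /w /cavg -/h; under eq_bigr do rewrite E.
have w0 : w 0 = v p.
  rewrite /w (eq_bigr (fun=> v p)) => [|k _]; last by rewrite mulr0 scale0r addr0.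
  by rewrite sumr_const card_ord -(mulr_natl (v p)) mulKf// pnatr_eq0 -lt0n.
pose D : set C := [set z | rnorm z <= 1].
have cD : compact D by exact: compact_disc.
have DU k (x : C) : D x -> U (p + (cis (k%:R * h) * x) *: b).
  move=> Dx; apply: dU; rewrite normrM norm_cis mul1r.
  by rewrite normc_rnorm -[1]/(1%:C%C) lecR.
have cline k : continuous (fun x : C => p + (cis (k%:R * h) * x) *: b).
  have -> : (fun x : C => p + (cis (k%:R * h) * x) *: b) =
      (fun x : C => p + x *: (cis (k%:R * h) *: b)).
    by apply/funext => x; rewrite scalerA mulrC.
  exact: line_continuous.
have cvD (k : 'I_N) (x : C) : D x ->
    {for x, continuous (fun x : C => v (p + (cis (k%:R * h) * x) *: b))}.
  move=> Dx; apply: (@continuous_comp _ _ _ (fun x : C => p + (cis (k%:R * h) * x) *: b) v).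
    exact: cline.
  by apply: cv; exact: DU.
have cwD (x : C) : D x -> {for x, continuous w}.
  move=> Dx.
  have cc : {for x, continuous (fun _ : C => N%:R^-1 : R)} by exact: cst_continuous.
  by apply: (continuousM cc); apply: continuous_sum_for => k; exact: cvD.
have cw : {within D, continuous w}.
  by apply: continuous_in_subspaceT => x /set_mem; exact: cwD.
have D0 : D !=set0 by exists 0; rewrite /D /= rnorm0.
(* Among the points where [w] is maximal on the disc, [x0] is one which is
   farthest from the centre. *)
have [x1 /set_mem Dx1 x1max] := compact_EVT_max D0 cD cw.
have {}x1max (x : C) : D x -> w x <= w x1 by move=> Dx; apply: x1max; exact/mem_set.
have [W oW Ww] := continuous_lt_open (w x1) cw.
have cK : compact (D `&` ~` W) by apply: compact_closedI => //; exact: open_closedC.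
have K0 : (D `&` ~` W) !=set0 by exists x1; split=> // /(Ww _ Dx1); rewrite ltxx.
have [x0 /set_mem[Dx0 Wx0] x0max] := compact_EVT_max K0 cK
  (continuous_subspaceT (@rnorm_continuous R C)).
have w01 : w x0 = w x1.
  by apply/eqP; rewrite eq_le x1max//= leNgt; apply/negP => /(Ww _ Dx0).
have [x0lt1|x0ge1] := ltP (rnorm x0) 1; last first.
  have [s sx0] : exists s, x0 = cis s.
    by apply: unit_cis; rewrite normc_rnorm; congr (_%:C)%C; apply/le_anti; rewrite Dx0.
  by rewrite -w0 (le_trans (x1max _ _)) -?w01 ?sx0 ?wcis ?NP// /D /= rnorm0.
(* Otherwise [x0] is an interior point: the mean value inequality holds on
   small discs around it, and fails if [w] is smaller at the point of the disc
   that lies farther out. *)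
pose P (k : 'I_N) (c : C) : Prop := v (p + (cis (k%:R * h) * x0) *: b) <=
  cmean (fun t => v (p + (cis (k%:R * h) * (x0 + cis t * c)) *: b)).
have near0 : \forall c \near (0 : C), forall k : 'I_N, P k c.
  apply: (@filter_forall C _ P (nbhs (0 : C)) (@nbhs_filter C 0)) => k; rewrite /P.
  pose q : T := p + (cis (k%:R * h) * x0) *: b.
  have [G [g [Gq [oG cg sg] vg]]] := loc q (DU _ _ Dx0).
  have : \forall l \near (0 : C), G (q + l *: (cis (k%:R * h) *: b)).
    apply: (@line_continuous R T q (cis (k%:R * h) *: b) 0).
    by rewrite scale0r addr0; exact: open_nbhs_nbhs.
  move=> /nbhs_rnormP[r r0 rG]; apply/nbhs_rnormP; exists r => // c.
  rewrite subr0 => cr.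
  have dG : in_disc G q ((cis (k%:R * h) * c) *: b).
    move=> l l1; rewrite [_ * c]mulrC -scalerA scalerA; apply: rG.
    rewrite subr0 (rnormZ l c) (le_lt_trans _ cr)// ler_piMl ?rnorm_ge0//.
    by move: l1; rewrite normc_rnorm -[1]/(1%:C%C) lecR.
  have -> : (fun t => v (p + (cis (k%:R * h) * (x0 + cis t * c)) *: b)) =
      (fun t => g (q + cis t *: ((cis (k%:R * h) * c) *: b))).
    apply/funext => t; rewrite -vg; last exact: in_disc_cis.
    by rewrite /q mulrDr scalerDl addrA scalerA [_ * (cis t * c)]mulrCA.
  by rewrite (vg q Gq); exact: sg.
have /nbhs_rnormP[r r0 rP] := near0.
pose u : C := if x0 == 0 then 1 else x0.
have u0 : 0 < rnorm u.
  rewrite lt0r rnorm_ge0 andbT /u; case: ifPn => [_|x00].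
    by rewrite /rnorm normr1 oner_eq0.
  by apply: contra x00 => /eqP/rnorm_eq0 ->.
pose m := Num.min (r / 2) (1 - rnorm x0).
have m0 : 0 < m by rewrite lt_min divr_gt0//= subr_gt0.
have mr : m < r by rewrite gt_min ltr_pdivrMr// ltr_pMr// ltr1n.
pose c : C := (m / rnorm u)%:C%C *: u.
have normpos (a : R) : 0 <= a -> complex.Re `|a%:C%C| = a.
  by move=> a0; rewrite ger0_norm ?lecR.
have cm : rnorm c = m.
  by rewrite rnormZ normpos ?divfK ?gt_eqF// divr_ge0// ltW.
have Dt t : D (x0 + cis t * c).
  rewrite /D /= (le_trans (ler_rnormD _ _))// (rnormZ (cis t) c) norm_cis mul1r cm.
  by rewrite -lerBrDl ge_min lexx orbT.
have circle t : {for t, continuous (fun t : R => x0 + cis t * c)}.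
  exact: (@circle_continuous R C).
have cwt : continuous (fun t => w (x0 + cis t * c)).
  move=> t; apply: (@continuous_comp _ _ _ (fun t : R => x0 + cis t * c) w).
    exact: circle.
  exact: cwD.
have mean : w x0 <= cmean (fun t => w (x0 + cis t * c)).
  have ck (k : 'I_N) : continuous
      (fun t => v (p + (cis (k%:R * h) * (x0 + cis t * c)) *: b)).
    move=> t; apply: (@continuous_comp _ _ _ (fun t : R => x0 + cis t * c)
      (fun x : C => v (p + (cis (k%:R * h) * x) *: b))); first exact: circle.
    by apply: cvD.
  rewrite /w cmeanZ; last by move=> t; apply: continuous_sum_for => k; exact: ck.
  rewrite (cmean_sum ck) ler_wpM2l ?invr_ge0 ?ler0n// ler_sum// => k _.
  by apply: rP; rewrite subr0 cm.
have wc : w (x0 + c) = w x1.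
  apply/eqP; rewrite eq_le x1max; last by have := Dt 0; rewrite cis0 mul1r.
  rewrite leNgt; apply/negP => lt1.
  have : cmean (fun t => w (x0 + cis t * c)) < w x1.
    by apply: cmean_lt => // [t|]; [exact: x1max|rewrite cis0 mul1r].
  by rewrite ltNge -w01 mean.
have Dc : D (x0 + c) by have := Dt 0; rewrite cis0 mul1r.
have : rnorm (x0 + c) <= rnorm x0.
  by apply: x0max; apply/mem_set; split=> // /(Ww _ Dc); rewrite wc ltxx.
rewrite leNgt => /negP[]; rewrite /c /u; case: ifPn => [/eqP ->|x00].
  rewrite rnorm0 add0r rnormZ mulr_gt0//.
    by rewrite normpos ?divr_gt0 ?divr_ge0 ?rnorm_ge0 ?ltW// /rnorm normr1.
  by rewrite /rnorm normr1.
have -> : x0 + (m / rnorm x0)%:C%C *: x0 = (1 + m / rnorm x0)%:C%C *: x0.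
  by rewrite rmorphD rmorph1 scalerDl scale1r.
rewrite rnormZ normpos ?addr_ge0 ?divr_ge0 ?rnorm_ge0 ?ltW//.
have {}u0 : 0 < rnorm x0 by move: u0; rewrite /u (negbTE x00).
by rewrite mulrDl mul1r ltrDl mulr_gt0// divr_gt0.
Qed.
End locality.

(** * Functions plurisubharmonic near a compact set *)

Section psho_closure.
Variables (R : realType) (n : nat).
Local Notation T := (Cn R n).
Implicit Types (X Y U G : set T) (u v w : T -> R).

Lemma psho_within X u : psho X u -> {within X, continuous u}.
Proof.
move=> /pshoP[U [v [[oU cv _] XU vu]]].
apply: (subspace_eq_continuous (f := v)) => [x /set_mem/vu//|].
by apply: continuous_in_subspaceT => x /set_mem/XU; exact: cv.
Qed.

Lemma psho_sub X Y u : Y `<=` X -> psho X u -> psho Y u.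
Proof.
move=> YX /pshoP[U [v [pv XU vu]]]; apply/pshoP; exists U, v; split=> //.
- exact: subset_trans XU.
- by move=> x /YX; exact: vu.
Qed.

Lemma psho_cst X c : psho X (fun=> c).
Proof. by apply/pshoP; exists setT, (fun=> c); split=> //; apply: cpsh_cst openT. Qed.

Lemma psho_scale X u c : 0 <= c -> psho X u -> psho X (fun x => c * u x).
Proof.
move=> c0 /pshoP[U [v [pv XU vu]]]; apply/pshoP.
exists U, (fun x => c * v x); split=> //; first exact: cpsh_scale.
by move=> x /vu ->.
Qed.

Lemma psho_common X u w : psho X u -> psho X w -> exists U v1 v2,
  [/\ cpsh U v1, cpsh U v2, X `<=` U, forall x, X x -> v1 x = u x
    & forall x, X x -> v2 x = w x].
Proof.
move=> /pshoP[U [v [pv XU vu]]] /pshoP[W [v' [pv' XW vw]]].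
have oUW : open (U `&` W) by apply: openI; [case: pv|case: pv'].
exists (U `&` W), v, v'; split=> //.
- by apply: cpsh_sub pv => // x [].
- by apply: cpsh_sub pv' => // x [].
- by move=> x Xx; split; [exact: XU|exact: XW].
Qed.

Lemma psho_add X u w : psho X u -> psho X w -> psho X (fun x => u x + w x).
Proof.
move=> pu pw; have [U [v [v' [pv pv' XU vu vw]]]] := psho_common pu pw.
apply/pshoP; exists U, (fun x => v x + v' x); split=> //; first exact: cpsh_add.
by move=> x Xx; rewrite vu ?vw.
Qed.

Lemma psho_max X u w : psho X u -> psho X w ->
  psho X (fun x => Num.max (u x) (w x)).
Proof.
move=> pu pw; have [U [v [v' [pv pv' XU vu vw]]]] := psho_common pu pw.
apply/pshoP; exists U, (fun x => Num.max (v x) (v' x)); split=> //.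
  exact: cpsh_max.
by move=> x Xx; rewrite vu ?vw.
Qed.

Lemma psho_local X u :
  (forall x, X x -> exists G w,
     [/\ G x, cpsh G w & forall y, G y -> u y = w y]) ->
  psho X u.
Proof.
move=> loc.
pose U := [set x | exists G w, [/\ G x, cpsh G w & forall y, G y -> u y = w y]].
have oU : open U.
  rewrite openE => x [G [w [Gx pw uw]]].
  have [oG _ _] := pw; apply: filterS (open_nbhs_nbhs (conj oG Gx)) => y Gy.
  by exists G, w.
by apply/pshoP; exists U, u; split=> //; apply: cpsh_local.
Qed.

End psho_closure.

(** * Borel sets and integration on compact sets *)

Section borel.
Variables (R : realType) (n : nat).
Local Notation T := (Cn R n).
Local Notation B := (BorelCn R n).
Implicit Types (A X : set T) (mu : probability B R).

Lemma open_borel A : open A -> measurable (A : set B).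
Proof. by move=> oA; exact: sub_sigma_algebra. Qed.

Lemma closed_borel A : closed A -> measurable (A : set B).
Proof.
move=> cA; have : measurable (~` A : set B) by apply: open_borel; exact: closed_openC.
by move=> /measurableC; rewrite setCK.
Qed.

Lemma compact_closed_Cn A : compact A -> closed A.
Proof. by apply: compact_closed; exact: norm_hausdorff. Qed.

Lemma compact_borel A : compact A -> measurable (A : set B).
Proof. by move=> /compact_closed_Cn; exact: closed_borel. Qed.

Lemma usc_measurable A (u : T -> \bar R) : measurable (A : set B) ->
  usc_on A u -> measurable_fun (A : set B) (u : B -> \bar R).
Proof.
move=> mA uscu; apply: (measurability _ (ErealGenInftyO.measurableE R)).
move=> _ [_ [a ->] <-]; have [W oW Wu] := usc_on_lt_open a uscu.
have -> : A `&` u @^-1` [set` `]-oo, a%:E[] = A `&` W.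
  by apply/seteqP; split=> x [Ax] /=; rewrite in_itv /= => /(Wu _ Ax).
by apply: measurableI => //; exact: open_borel.
Qed.

Lemma within_measurable A (f : T -> R) : measurable (A : set B) ->
  {within A, continuous f} -> measurable_fun (A : set B) (f : B -> R).
Proof.
by move=> mA cf; apply/measurable_EFinP; apply: usc_measurable => //; exact: usc_on_continuous.
Qed.

Lemma compact_bound X (f : T -> R) : compact X -> {within X, continuous f} ->
  exists2 M, 0 < M & forall x, X x -> `|f x| <= M.
Proof.
move=> cX cf.
have [->|/set0P X0] := eqVneq X set0; first by exists 1.
have cNf : {within X, continuous (fun x => - f x)}.
  by move=> x; apply: continuousN; exact: cf.
have [a _ fa] := compact_EVT_max X0 cX cf.
have [b _ fb] := compact_EVT_max X0 cX cNf.
exists (`|f a| + `|f b| + 1) => [|x Xx]; first by rewrite ltr_wpDl ?addr_ge0.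
have := fa x (mem_set Xx); have := fb x (mem_set Xx).
have := ler_norm (f a); have := ler_norm (- f b); rewrite normrN.
have := normr_ge0 (f a); have := normr_ge0 (f b).
rewrite ler_norml => *; apply/andP; split; lra.
Qed.

Lemma within_integrable mu X (f : T -> R) : compact X ->
  {within X, continuous f} -> mu.-integrable (X : set B) (EFin \o f).
Proof.
move=> cX cf; have mX := compact_borel cX.
apply: measurable_bounded_integrable => //.
- by rewrite (le_lt_trans (probability_le1 _ mX))// ltry.
- exact: within_measurable.
have [M M0 fM] := compact_bound cX cf.
by exists M; split; [exact: num_real|move=> y My x Xx; exact: (le_trans (fM x Xx) (ltW My))].
Qed.

End borel.

(** * The distance to a set *)
Section capped_distance.
Variables (R : realType) (n : nat).
Local Notation T := (Cn R n).
Implicit Types (A : set T) (x y : T).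

(** Capping the distance at 1 bounds it and gives it a sensible value, namely 1,
    when [A] is empty. *)
Definition cdist A x : R := inf [set r | r = 1 \/ exists2 y, A y & r = rnorm (x - y)].

Let S A x := [set r : R | r = 1 \/ exists2 y, A y & r = rnorm (x - y)].

Let has_infS A x : has_inf (S A x).
Proof.
split; first by exists 1; left.
by exists 0 => r [->|[y _ ->]]; rewrite ?rnorm_ge0.
Qed.

Let S_lb A x r : S A x r -> cdist A x <= r.
Proof. by move=> Sr; apply: ge_inf => //; case: (has_infS A x). Qed.

Let le_S A x a : (forall r, S A x r -> a <= r) -> a <= cdist A x.
Proof. by move=> aS; apply: lb_le_inf; [case: (has_infS A x)|exact: aS]. Qed.

Lemma cdist_ge0 A x : 0 <= cdist A x.
Proof. by apply: le_S => r [->|[y _ ->]]; rewrite ?rnorm_ge0. Qed.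

Lemma cdist_le1 A x : cdist A x <= 1.
Proof. by apply: S_lb; left. Qed.

Lemma cdist_le A x y : A y -> cdist A x <= rnorm (x - y).
Proof. by move=> Ay; apply: S_lb; right; exists y. Qed.

Lemma cdist_in A x : A x -> cdist A x = 0.
Proof.
by move=> Ax; apply/le_anti; rewrite cdist_ge0 (le_trans (cdist_le x Ax))// subrr rnorm0.
Qed.

Lemma cdist_lip A x y : cdist A x <= cdist A y + rnorm (x - y).
Proof.
rewrite -lerBlDr; apply: le_S => r [->|[z Az ->]].
  by rewrite lerBlDr (le_trans (cdist_le1 _ _))// lerDl rnorm_ge0.
by rewrite lerBlDr (le_trans (cdist_le x Az))// [leRHS]addrC ler_rdistD.
Qed.

Lemma cdist_gt0 A x : closed A -> ~ A x -> 0 < cdist A x.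
Proof.
move=> cA nAx; have /nbhs_rnormP[r r0 rA] : nbhs x (~` A).
  exact: open_nbhs_nbhs (conj (closed_openC cA) nAx).
apply: (@lt_le_trans _ _ (Num.min r 1)); first by rewrite lt_min r0 ltr01.
apply: le_S => s [->|[y Ay ->]]; first by rewrite ge_min lexx orbT.
rewrite ge_min leNgt; apply/orP; left; apply/negP => xy.
by apply: (rA y) => //; rewrite rdistC.
Qed.

Lemma cdist_continuous A : continuous (cdist A).
Proof.
move=> x; apply/(@continuous_rnormP R T) => e e0; exists e => // y yx.
rewrite ltr_distl; have := cdist_lip A x y; have := cdist_lip A y x.
by rewrite (rdistC x y); lra.
Qed.

End capped_distance.

(** * The Riesz representation theorem on a compact set *)

Section mass.
Variables (R : realType) (n : nat).
Local Notation B := (BorelCn R n).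

Lemma measure_full_inter (mu : probability B R) (X A : set B) : measurable X ->
  measurable A -> mu X = 1%E -> mu A = mu (A `&` X).
Proof.
move=> mX mA muX; apply/eqP; rewrite eq_le; apply/andP; split; last first.
  by apply: le_measure; rewrite ?inE//; exact: measurableI.
have mCX : measurable (~` X) by exact: measurableC.
have sub : A `<=` (A `&` X) `|` ~` X.
  by move=> x Ax; have [Xx|nXx] := pselect (X x); [left|right].
apply: le_trans (le_measure mu _ _ sub) _; rewrite ?inE//.
  by apply: measurableU => //; exact: measurableI.
apply: le_trans (measureU2 _ _ _) _ => //; first exact: measurableI.
have mC0 : mu (~` X) = 0%E by rewrite probability_setC// [Z in (_ - Z)%E]muX subee.
by rewrite [Z in (_ + Z)%E]mC0 adde0.
Qed.

(** The decomposition of a number into layers of height 1. *)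
Lemma sum_clamp (t : R) N : 0 <= t ->
  \sum_(k < N) Num.min 1 (Num.max 0 (t - k%:R)) = Num.min t N%:R.
Proof.
move=> t0; elim: N => [|N IH]; first by rewrite big_ord0; apply/esym/min_idPr.
rewrite big_ord_recr /= IH -natr1 /Num.max /Num.min.
by do ?case: ifPn; rewrite -?leNgt; lra.
Qed.

End mass.

Section riesz.
Variables (R : realType) (n : nat).
Local Notation T := (Cn R n).
Local Notation B := (BorelCn R n).
Variable X : set T.
Hypothesis cX : compact X.
Variable L : (T -> R) -> R.
Local Notation CX f := {within X, continuous f}.
Hypothesis LD : forall f g : T -> R, CX f -> CX g -> L (fun x => f x + g x) = L f + L g.
Hypothesis LZ : forall (c : R) (f : T -> R), CX f -> L (fun x => c * f x) = c * L f.
Hypothesis L_ge0 : forall f : T -> R, CX f -> (forall x, X x -> 0 <= f x) -> 0 <= L f.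
Hypothesis L1 : L (fun=> 1) = 1.
Implicit Types (V U A : set T) (f g : T -> R).

Let C_cst (c : R) : CX (fun _ : T => c : R).
Proof. by apply: continuous_subspaceT => x; exact: cst_continuous. Qed.

Let CD f g : CX f -> CX g -> CX (fun x => f x + g x).
Proof. by move=> cf cg x; exact: (continuousD (cf x) (cg x)). Qed.

Let CZ (c : R) f : CX f -> CX (fun x => c * f x).
Proof.
move=> cf x.
have cc : {for x, continuous ((fun=> c) : subspace X -> R)} by exact: cst_continuous.
exact: (continuousM cc (cf x)).
Qed.

Let Cmax f g : CX f -> CX g -> CX (fun x => Num.max (f x) (g x)).
Proof. by move=> cf cg x; exact: (continuous_max (cf x) (cg x)). Qed.

Let Cmin f g : CX f -> CX g -> CX (fun x => Num.min (f x) (g x)).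
Proof. by move=> cf cg x; exact: (continuous_min (cf x) (cg x)). Qed.

Let Lcst (c : R) : L (fun=> c) = c.
Proof.
have -> : (fun _ : T => c) = (fun=> c * 1) by apply/funext => x; rewrite mulr1.
by rewrite (LZ _ (@C_cst 1)) L1 mulr1.
Qed.

Let le_L f g : CX f -> CX g -> (forall x, X x -> f x <= g x) -> L f <= L g.
Proof.
move=> cf cg fg; rewrite -subr_ge0.
have -> : L g - L f = L (fun x => g x + (-1) * f x).
  by rewrite LD ?LZ ?mulN1r//; exact: CZ.
apply: L_ge0; first by apply: CD => //; exact: CZ.
by move=> x /fg; rewrite mulN1r subr_ge0.
Qed.

Let Lsum N (f : 'I_N -> T -> R) : (forall k, CX (f k)) ->
  CX (fun x => \sum_k f k x) /\ L (fun x => \sum_k f k x) = \sum_k L (f k).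
Proof.
elim: N f => [|N IH] f cf.
  have -> : (fun x => \sum_k f k x) = (fun=> 0) by apply/funext => x; rewrite big_ord0.
  by rewrite big_ord0 Lcst; split=> //; exact: C_cst.
have -> : (fun x => \sum_k f k x) = (fun x => f ord0 x + \sum_k f (lift ord0 k) x).
  by apply/funext => x; rewrite big_ord_recl.
have [c1 e1] := IH (fun k => f (lift ord0 k)) (fun k => cf _).
by rewrite big_ord_recl LD// e1; split=> //; exact: CD.
Qed.

Definition test V f := [/\ CX f, forall x, X x -> 0 <= f x <= 1
  & forall x, X x -> ~ V x -> f x = 0].

(** The mass of the open set [V] for the measure to be constructed. *)
Definition content V : \bar R := ereal_sup [set (L f)%:E | f in test V].

Let test_le_content V f : test V f -> ((L f)%:E <= content V)%E.
Proof. by move=> tf; apply: ereal_sup_ubound; exists f. Qed.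

Let content_le V (a : \bar R) : (forall f, test V f -> ((L f)%:E <= a)%E) -> (content V <= a)%E.
Proof. by move=> H; apply: ge_ereal_sup => _ [f tf <-]; exact: H. Qed.

Let content_ge0 V : (0 <= content V)%E.
Proof.
have := @test_le_content V (fun=> 0); rewrite Lcst; apply.
split=> [|x _|//]; first exact: C_cst.
by rewrite lexx ler01.
Qed.

Let content_le1 V : (content V <= 1)%E.
Proof.
apply: content_le => f [cf f01 _]; rewrite lee_fin -[leRHS]L1.
by apply: le_L => // x /f01/andP[].
Qed.

Let le_content V U : V `<=` U -> (content V <= content U)%E.
Proof.
move=> VU; apply: content_le => f [cf f01 f0]; apply: test_le_content; split=> // x Xx nUx.
by apply: f0 => // /VU.
Qed.

Let content0 V : X `&` V = set0 -> content V = 0%E.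
Proof.
move=> XV; apply/eqP; rewrite eq_le content_ge0 andbT; apply: content_le => f [cf _ f0].
suff : L f <= L (fun=> 0) by rewrite Lcst lee_fin.
apply: le_L => // x Xx.
by rewrite f0// => Vx; have : (X `&` V) x by []; rewrite XV.
Qed.

Let content_full V : X `<=` V -> content V = 1%E.
Proof.
move=> XV; apply/eqP; rewrite eq_le content_le1 /=; have := @test_le_content V (fun=> 1).
rewrite Lcst; apply; split=> [|x _|x /XV//]; first exact: C_cst.
by rewrite lexx ler01.
Qed.

(** These functions increase to the indicator function of an open set. *)
Let plateau (V : set T) (N : nat) : T -> R :=
  fun x => Num.min 1 (N%:R * cdist (~` V) x).

Let test_plateau V N : test V (plateau V N).
Proof.
split=> [|x _|x _ nVx].
- apply: Cmin; first exact: C_cst.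
  by apply: CZ; apply: continuous_subspaceT; exact: cdist_continuous.
- by rewrite le_min ler01 mulr_ge0 ?cdist_ge0 ?ler0n//= ge_min lexx.
- by rewrite /plateau cdist_in// mulr0; apply/min_idPr; exact: ler01.
Qed.

(** Where a test function [f] of the union is at least [e], which is a compact
    set, finitely many plateaus have a sum at least 1, by compactness. *)
Let content_sigma_subadditive (V : (set T)^nat) : (forall k, open (V k)) ->
  (content (\bigcup_k V k) <= \sum_(k <oo) content (V k))%E.
Proof.
move=> oV; apply: content_le => f [cf f01 f0].
apply/lee_addgt0Pr => e e0.
have [W oW Wf] := continuous_lt_open e cf.
have cK : compact (X `&` ~` W) by apply: compact_closedI => //; exact: open_closedC.
have /compact_near_coveringP nK := cK.
have [|N _ NP] := nK nat \oo
   (fun N x => 1 <= \sum_(k < N) plateau (V k) N x) _.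
  move=> x [Xx Wx]; have fx : e <= f x by rewrite leNgt; apply/negP => /(Wf x Xx).
  have [[k _ Vx]|nVx] := pselect ((\bigcup_k V k) x); last first.
    by move: fx; rewrite f0// leNgt e0.
  have c0 : 0 < cdist (~` V k) x.
    by apply: cdist_gt0 => [|//]; exact: open_closedC.
  have c20 : 0 < cdist (~` V k) x / 2 by rewrite divr_gt0.
  have near1 : \forall y \near x, cdist (~` V k) x / 2 < cdist (~` V k) y.
    have /cvgrPdist_lt/(_ _ c20) := @cdist_continuous R n (~` V k) x.
    by apply: filterS => y; rewrite ltr_distlC => /andP[+ _]; lra.
  exists ([set y | cdist (~` V k) x / 2 < cdist (~` V k) y],
      [set N | (k < N)%N /\ (cdist (~` V k) x / 2)^-1 < N%:R]).
    split=> //=; near=> N; split; near: N; first exact: nbhs_infty_gt.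
    exact: nbhs_infty_gtr.
  move=> [y N] /= [yP [kN NP]].
  rewrite (bigD1 (Ordinal kN))//= {1}/plateau min_l.
    rewrite lerDl sumr_ge0// => i _.
    by rewrite le_min ler01 mulr_ge0 ?cdist_ge0 ?ler0n.
  by rewrite -[leLHS](mulVf (lt0r_neq0 c20)) ler_pM ?invr_ge0 ?(ltW c20) ?(ltW NP) ?(ltW yP).
have NK x : X x -> f x <= e + \sum_(k < N) plateau (V k) N x.
  move=> Xx; have s0 : 0 <= \sum_(k < N) plateau (V k) N x.
    by apply: sumr_ge0 => k _; rewrite le_min ler01 mulr_ge0 ?cdist_ge0 ?ler0n.
  have [Wx|nWx] := pselect (W x).
    by rewrite (le_trans (ltW ((Wf x Xx).1 Wx)))// lerDl.
  have /andP[_ f1] := f01 x Xx.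
  rewrite (le_trans f1)// (le_trans (NP N (leqnn N) x _))//.
  by rewrite lerDr ltW.
have [cS LS] := Lsum (fun k : 'I_N => let: And3 c _ _ := test_plateau (V k) N in c).
have : L f <= e + \sum_(k < N) L (plateau (V k) N).
  rewrite -LS -[X in X + _](Lcst e) -LD//.
  by apply: le_L => //; apply: CD.
rewrite -lee_fin => /le_trans; apply; rewrite EFinD addeC; apply: leeD => //.
rewrite -sumEFin (@le_trans _ _ (\sum_(k < N) content (V k))%E)//.
  by apply: lee_sum => k _; exact: test_le_content.
rewrite -(big_mkord xpredT (fun k => content (V k))).
exact: nneseries_lim_ge.
Unshelve. all: by end_near. Qed.

Let oCX : open (~` X).
Proof. exact: closed_openC (compact_closed_Cn cX). Qed.

Definition riesz_outer A : \bar R := ereal_inf [set content V | V in [set V | open V /\ A `<=` V]].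

Let outer_le A V : open V -> A `<=` V -> (riesz_outer A <= content V)%E.
Proof. by move=> oV AV; apply: ereal_inf_lbound; exists V. Qed.

Let le_outer A (a : \bar R) :
  (forall V, open V -> A `<=` V -> (a <= content V)%E) -> (a <= riesz_outer A)%E.
Proof. by move=> H; apply: le_ereal_inf_tmp => _ [V [oV AV] <-]; exact: H. Qed.

Let outer_open V : open V -> riesz_outer V = content V.
Proof.
move=> oV; apply/eqP; rewrite eq_le outer_le//=; apply: le_outer => U _ VU.
exact: le_content.
Qed.

Let outer_ge0 A : (0 <= riesz_outer A)%E.
Proof. by apply: le_outer => V _ _; exact: content_ge0. Qed.

Let outer_fin A : riesz_outer A \is a fin_num.
Proof.
rewrite ge0_fin_numE//; apply: le_lt_trans (ltry 1).
by rewrite (le_trans (outer_le openT (@subsetT _ A)))// content_le1.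
Qed.

Let outer_mono : {homo riesz_outer : A U / A `<=` U >-> (A <= U)%E}.
Proof.
move=> A U AU; apply: le_outer => V oV UV; apply: outer_le => //.
exact: subset_trans UV.
Qed.

Let outer0 : riesz_outer set0 = 0%E.
Proof. by rewrite (outer_open open0) content0// setI0. Qed.

Let outer_sigma_subadditive : sigma_subadditive riesz_outer.
Proof.
move=> F; apply/lee_addgt0Pr => e e0.
have pick k : exists V, [/\ open V, F k `<=` V &
    (content V <= riesz_outer (F k) + (e / (2 ^ k.+1)%:R)%:E)%E].
  have ek : 0 < e / (2 ^ k.+1)%:R by rewrite divr_gt0// ltr0n expn_gt0.
  have [_ [V [oV FV] <-] lV] := lb_ereal_inf_adherent ek (outer_fin (F k)).
  by exists V; split=> //; exact: ltW.
have [V VP] := choice pick.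
apply: (@le_trans _ _ (content (\bigcup_k V k))).
  apply: outer_le; first by apply: bigcup_open => k _; case: (VP k).
  by apply: subset_bigcup => k _; case: (VP k).
apply: le_trans (content_sigma_subadditive _) _; first by move=> k; case: (VP k).
apply: le_trans (epsilon_trick xpredT (fun k => outer_ge0 (F k)) (ltW e0)).
by apply: lee_nneseries => k *; [exact: content_ge0|case: (VP k)].
Qed.

(** A test function of [U `&` V], lowered by [e], vanishes on a neighbourhood of
    the complement of [V]. Added to a test function of that neighbourhood it is
    a test function of [U]. *)
Let outer_caratheodory V A : open V ->
  (riesz_outer (A `&` V) + riesz_outer (A `&` ~` V) <= riesz_outer A)%E.
Proof.
move=> oV; apply: le_outer => U oU AU.
rewrite -leeBrDr ?outer_fin//.
apply: (@le_trans _ _ (content (U `&` V))).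
  by rewrite -outer_open; [apply: outer_mono; exact: setSI|exact: openI].
apply: content_le => f [cf f01 f0]; rewrite leeBrDr ?outer_fin//.
apply/lee_addgt0Pr => e e0.
have [W oW Wf] := continuous_lt_open e cf.
pose U' := U `&` (W `|` ~` X).
have oU' : open U'.
  by apply: openI => //; apply: openU.
have sub : A `&` ~` V `<=` U'.
  move=> x [Ax nVx]; split; first exact: AU.
  have [Xx|] := pselect (X x); last by right.
  by left; apply/(Wf x Xx); rewrite f0// => -[].
have outer_U' := outer_le oU' sub.
rewrite (le_trans (leeD2l _ outer_U'))//.
pose f' x := Num.max (f x - e) 0.
have cf' : CX f'.
  by apply: Cmax; [apply: CD => //; exact: C_cst|exact: C_cst].
have Lf : L f <= L f' + e.
  rewrite -[X in _ + X](Lcst e) -LD//; apply: le_L => //; first exact: CD.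
  by move=> x Xx; rewrite -lerBlDr le_max lexx.
have contentU' : (content U' <= (fine (content U) - L f')%:E)%E.
  apply: content_le => g [cg g01 g0]; rewrite lee_fin lerBrDl.
  rewrite -LD// -lee_fin fineK; last first.
    by rewrite ge0_fin_numE ?content_ge0// (le_lt_trans (content_le1 _))// ltry.
  apply: test_le_content; split=> [|x Xx|x Xx nUx].
  - exact: CD.
  - have /andP[g_ge0 g_le1] := g01 x Xx; have /andP[f_ge0 f_le1] := f01 x Xx.
    rewrite addr_ge0 ?le_max ?lexx ?orbT//=.
    have [Wx|nWx] := pselect (W x).
      by rewrite /f' max_r ?add0r// subr_le0 ltW//; apply/Wf.
    rewrite g0 ?addr0; [by rewrite ge_max ler01 andbT; lra|done|].
    by move=> [_ []].
  - rewrite g0 => [|//|[]//]; rewrite addr0 /f' f0// => [|[]//].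
    by rewrite max_r// sub0r oppr_le0 ltW.
rewrite (le_trans (leeD2l _ contentU'))// -EFinD.
have -> : content U = (fine (content U))%:E.
  by rewrite fineK// ge0_fin_numE ?content_ge0// (le_lt_trans (content_le1 _))// ltry.
by rewrite -EFinD lee_fin /=; lra.
Qed.

(** The outer measure generated by the content of open sets is a measure on its
    Caratheodory sets, which include the open sets and hence the Borel sets. *)
Lemma riesz_measure : exists mu : probability B R, mu X = 1%E /\
  forall V, open V -> mu V = content V.
Proof.
pose om : outer_measure R T := HB.pack riesz_outer
  (isOuterMeasure.Build R T riesz_outer outer0 outer_ge0 outer_mono outer_sigma_subadditive).
have cara A : measurable (A : set B) -> om.-caratheodory A.
  move: A; apply: smallest_sub.
    split.
    - exact: caratheodory_measurable_set0.
    - by move=> A cA; rewrite setTD; exact: caratheodory_measurable_setC.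
    - exact: caratheodory_measurable_bigcup.
  by move=> A oA; apply: le_caratheodory_measurable => U; exact: outer_caratheodory.
have sigma : semi_sigma_additive (riesz_outer : set B -> \bar R).
  move=> F mF tF mUF.
  apply: (@caratheodory_measure_sigma_additive R T om) => //; last exact: cara.
  by move=> k; exact: cara.
pose m0 := isMeasure.Build _ B R riesz_outer outer0 outer_ge0 sigma.
pose M : {measure set B -> \bar R} := HB.pack (riesz_outer : set B -> \bar R) m0.
have M1 : M setT = 1%E by rewrite /= (outer_open openT) content_full.
pose p1 := Measure_isProbability.Build _ B R M M1.
pose P : probability B R := HB.pack (riesz_outer : set B -> \bar R) m0 p1.
exists P; split; last by move=> V oV; exact: outer_open.
have mX : measurable (~` X : set B) by exact: open_borel.
rewrite -[X]setCK probability_setC//= [X in (1 - X)%E](_ : _ = 0%E) ?sube0//.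
by rewrite /P /= (outer_open oCX) content0// setICr.
Qed.

(** Only the inequality of [L] and the integral on functions between 0 and 1
    needs a proof: affine changes of variable extend it to all functions, and
    replacing [f] by its opposite reverses it. Such an [f] is cut into [N + 1]
    layers; each layer vanishes off the open set where the preceding one is equal
    to 1, so that the sums differ by one layer at most. *)
Theorem riesz : exists mu : probability B R, mu X = 1%E /\
  forall f, CX f -> (L f)%:E = (\int[mu]_(x in X) (f x)%:E)%E.
Proof.
have [mu [muX mu_open]] := riesz_measure; exists mu; split=> //.
have mX : measurable (X : set B) by exact: compact_borel.
have int f : CX f -> mu.-integrable (X : set B) (EFin \o f).
  exact: within_integrable.
have cst c : (\int[mu]_(x in X) c = c)%R.
  by rewrite Rintegral_cst// [X in fine X]muX mulr1.
suff unit f : CX f -> (forall x, X x -> 0 <= f x <= 1) -> L f <= (\int[mu]_(x in X) f x)%R.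
  have bounded f : CX f -> L f <= (\int[mu]_(x in X) f x)%R.
    move=> cf; have [M M0 fM] := compact_bound cX cf.
    have iM0 : 0 < M^-1 / 2 by rewrite divr_gt0 ?invr_gt0.
    pose g x := M^-1 / 2 * (f x + M).
    have cfM : CX (fun x => f x + M) by apply: CD.
    have cg : CX g by exact: CZ.
    have := unit g cg _; rewrite /g LZ// RintegralZl//; last exact: int.
    rewrite ler_pM2l// LD// Lcst RintegralD//; try exact: int.
    rewrite cst lerD2r; apply => x /fM; rewrite ler_norml => /andP[h1 h2].
    rewrite mulr_ge0 ?(ltW iM0)//=; last lra.
    by rewrite -mulrA ler_pdivrMl// mulr1 mulrC ler_pdivrMr//; lra.
  move=> f cf; rewrite -[RHS]fineK; last exact/integrable_fin_num/int.
  congr EFin; apply/le_anti; rewrite bounded//=.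
  have cNf : CX (fun x => -1 * f x) by exact: CZ.
  have := bounded _ cNf; rewrite LZ// RintegralZl//; last exact: int.
  by rewrite !mulN1r lerN2.
move=> cf f01; apply/ler_addgt0Pr => e e0.
have [N Ne] : exists N : nat, N.+1%:R^-1 < e.
  exists (Num.truncn e^-1); rewrite invf_plt ?posrE// ?ltr0n//; exact: truncnS_gt.
have N0 : 0 < N.+1%:R :> R by rewrite ltr0n.
pose h k x := Num.min 1 (Num.max 0 (N.+1%:R * f x - k%:R)).
have ch k : CX (h k).
  apply: Cmin; first exact: C_cst.
  apply: Cmax; first exact: C_cst.
  by apply: CD; [exact: CZ|exact: C_cst].
have h01 k x : 0 <= h k x <= 1 by rewrite le_min ler01 le_max lexx ge_min lexx.
have sumh x : X x -> \sum_(k < N.+1) h k x = N.+1%:R * f x.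
  move=> /f01/andP[f_ge0 f_le1]; rewrite sum_clamp ?mulr_ge0 ?ler0n//.
  by apply/min_idPl; rewrite ger_pMr.
have L1h k : L (h k) <= 1.
  by rewrite -L1; apply: le_L => // x _; case/andP: (h01 k x).
(* The measure of the set where [f > (k + 1) / (N + 1)] lies in between. *)
have Lh k : L (h k.+1) <= (\int[mu]_(x in X) h k x)%R.
  have [W oW Wf] := continuous_gt_open (k.+1%:R) (@CZ N.+1%:R f cf).
  rewrite -lee_fin /Rintegral fineK; last exact/integrable_fin_num/int.
  apply: (@le_trans _ _ (mu W)).
    rewrite mu_open//; apply: test_le_content; split=> // x Xx /(contra_not (Wf x Xx).2).
    move/negP; rewrite -leNgt => le; rewrite /h max_l ?subr_le0//.
    by rewrite min_r.
  have mW : measurable (W : set B) by exact: open_borel.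
  rewrite (measure_full_inter mX mW muX) -(integral_indic mu mX mW).
  apply: ge0_le_integral => //.
  - exact/measurable_EFinP/measurable_indic.
  - by apply/measurable_EFinP; exact: within_measurable mX (ch k).
  move=> x Xx; rewrite lee_fin indicE; case: (boolP (x \in W)) => [|_].
    rewrite inE => /(Wf x Xx) lt; rewrite /h le_min lexx /= le_max; apply/orP; right.
    by move: lt; rewrite -natr1; lra.
  by case/andP: (h01 k x).
have Ih m : CX (fun x => \sum_(k < m) h k x) /\
    (\int[mu]_(x in X) (\sum_(k < m) h k x) = \sum_(k < m) \int[mu]_(x in X) h k x)%R.
  elim: m => [|m [cm IH]].
    have -> : (fun x => \sum_(k < 0) h k x) = (fun=> 0).
      by apply/funext => x; rewrite big_ord0.
    by rewrite big_ord0 cst; split=> //; exact: C_cst.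
  have -> : (fun x => \sum_(k < m.+1) h k x) = (fun x => \sum_(k < m) h k x + h m x).
    by apply/funext => x; rewrite big_ord_recr.
  split; first exact: CD.
  by rewrite big_ord_recr /= RintegralD ?IH//; exact: int.
have I0 k : 0 <= (\int[mu]_(x in X) h k x)%R.
  by apply: Rintegral_ge0 => x _; case/andP: (h01 k x).
have [_ LS] := Lsum (fun k : 'I_N.+1 => ch k).
have : N.+1%:R * L f <= 1 + N.+1%:R * (\int[mu]_(x in X) f x)%R.
  rewrite -LZ// -RintegralZl//; last exact: int.
  have -> : (\int[mu]_(x in X) (N.+1%:R * f x) = \int[mu]_(x in X) (\sum_(k < N.+1) h k x))%R.
    by apply: eq_Rintegral => x /set_mem/sumh ->.
  rewrite (Ih N.+1).2 big_ord_recr /=.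
  apply: (@le_trans _ _ (L (fun x => \sum_(k < N.+1) h k x))).
    by apply: le_L => [||x /sumh ->//]; [exact: CZ|exact: (Ih N.+1).1].
  rewrite LS big_ord_recl lerD//.
  rewrite (@le_trans _ _ (\sum_(k < N) (\int[mu]_(x in X) h k x)%R))//.
    by apply: ler_sum => k _; exact: Lh.
  by rewrite lerDl.
move=> NL; rewrite -(ler_pM2l N0); apply: le_trans NL _.
rewrite [leRHS]mulrDr [leRHS]addrC lerD2r.
by rewrite -ler_pdivrMl// mulr1 ltW.
Qed.

End riesz.

(** * The Hahn-Banach theorem for superlinear functionals *)

Section hahn_banach.
Variables (R : realType) (V : lmodType R) (P : set V).
Hypothesis PD : forall f g, P f -> P g -> P (f + g).
Hypothesis PZ : forall (c : R) f, P f -> P (c *: f).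
Implicit Types (p q : V -> R) (f g h : V).

Definition superlinear p :=
  (forall f g, P f -> P g -> p f + p g <= p (f + g)) /\
  (forall (c : R) f, 0 < c -> P f -> c * p f <= p (c *: f)).

Let PN f : P f -> P (- f).
Proof. by move=> Pf; rewrite -scaleN1r; exact: PZ. Qed.

Lemma superlinear0 p f : superlinear p -> P f -> p 0 = 0.
Proof.
move=> [pD pZ] Pf; have P0 : P 0 by rewrite -(scale0r f); exact: PZ.
have := pD _ _ P0 P0; rewrite addr0.
have h : 0 < 2^-1 :> R by rewrite invr_gt0.
by have := pZ _ _ h P0; rewrite scaler0; lra.
Qed.

Lemma superlinear_leN p f : superlinear p -> P f -> p f <= - p (- f).
Proof.
move=> sp Pf; have := sp.1 _ _ Pf (PN Pf).
by rewrite subrr (superlinear0 sp Pf) -lerBrDr sub0r.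
Qed.

(** The least superlinear functional above [p] whose value at [- h] is at least
    [- p h]; it can be equal to [p] only if [p] changes sign with [h]. *)
Definition tilt p h f : R := sup [set p (f + t *: h) - t * p h | t in [set t | 0 <= t]].

Let tilt_sup p h f : superlinear p -> P h -> P f ->
  has_sup [set p (f + t *: h) - t * p h | t in [set t | 0 <= t]].
Proof.
move=> sp Ph Pf; split; first by exists (p (f + 0 *: h) - 0 * p h), 0 => /=.
exists (- p (- f)) => _ [t /= t0 <-].
have Pt : P (f + t *: h) by apply: PD => //; exact: PZ.
have := sp.1 _ _ Pt (PN Pf); rewrite addrAC subrr add0r.
have [->|t1] := eqVneq t 0.
  by rewrite scale0r addr0 (superlinear0 sp Ph); lra.
suff -> : p (t *: h) = t * p h by lra.
have {t0}t1 : 0 < t by rewrite lt_def t1.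
apply/le_anti; rewrite sp.2// andbT.
have t2 : 0 < t^-1 by rewrite invr_gt0.
have := sp.2 _ _ t2 (PZ t Ph); rewrite scalerA mulVf ?gt_eqF// scale1r.
by rewrite ler_pdivrMl.
Qed.

Let tilt_ge p h f t : superlinear p -> P h -> P f -> 0 <= t ->
  p (f + t *: h) - t * p h <= tilt p h f.
Proof.
by move=> sp Ph Pf t0; apply: ub_le_sup; [case: (tilt_sup sp Ph Pf)|exists t].
Qed.

Let tilt_le p h f a : superlinear p -> P h -> P f ->
  (forall t, 0 <= t -> p (f + t *: h) - t * p h <= a) -> tilt p h f <= a.
Proof.
move=> sp Ph Pf ta; apply: ge_sup; first by case: (tilt_sup sp Ph Pf).
by move=> _ [t t0 <-]; exact: ta.
Qed.

Lemma tilt_superlinear p h : superlinear p -> P h -> superlinear (tilt p h).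
Proof.
move=> sp Ph; split=> [f g Pf Pg|c f c0 Pf].
  rewrite -lerBrDr; apply: tilt_le => // t t0; rewrite lerBrDr addrC -lerBrDr.
  apply: tilt_le => // s s0; rewrite lerBrDr.
  apply: le_trans (tilt_ge sp Ph (PD Pf Pg) (addr_ge0 s0 t0)).
  have Pt : P (f + t *: h) by apply: PD => //; exact: PZ.
  have Ps : P (g + s *: h) by apply: PD => //; exact: PZ.
  have := sp.1 _ _ Pt Ps.
  rewrite addrACA -scalerDl [t + s]addrC; lra.
rewrite mulrC -ler_pdivlMr//; apply: tilt_le => // t t0.
rewrite ler_pdivlMr//.
have := tilt_ge sp Ph (PZ c Pf) (mulr_ge0 (ltW c0) t0).
apply: le_trans.
have Pt : P (f + t *: h) by apply: PD => //; exact: PZ.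
have := sp.2 _ _ c0 Pt; rewrite scalerDr scalerA; lra.
Qed.

Lemma le_tilt p h f : superlinear p -> P h -> P f -> p f <= tilt p h f.
Proof.
by move=> sp Ph Pf; have := tilt_ge sp Ph Pf (lexx 0); rewrite scale0r addr0 mul0r subr0.
Qed.

Lemma tiltN p h : superlinear p -> P h -> - p h <= tilt p h (- h).
Proof.
move=> sp Ph; have := tilt_ge sp Ph (PN Ph) ler01.
by rewrite scale1r addNr (superlinear0 sp Ph) mul1r sub0r.
Qed.

(** A maximal superlinear functional is linear: tilting it in any direction
    cannot increase it. Tilting [p] beforehand in the direction [g] forces the
    value at [g]. *)
Theorem hahn_banach p g : superlinear p -> P g -> exists L : V -> R,
  [/\ forall f h, P f -> P h -> L (f + h) = L f + L h,
      forall (c : R) f, P f -> L (c *: f) = c * L f,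
      forall f, P f -> p f <= L f & L g = p g].
Proof.
move=> sp Pg; pose p1 := tilt p g.
have sp1 : superlinear p1 by exact: tilt_superlinear.
pose K := {q | superlinear q /\ forall f, P f -> p1 f <= q f}.
pose le (q r : K) := `[< forall f, P f -> sval q f <= sval r f >].
pose p1K : K := exist _ p1 (conj sp1 (fun f _ => lexx (p1 f))).
have [||A tA|q qmax] := @ZL_preorder K p1K le.
- by move=> q; apply/asboolP.
- by move=> q r s /asboolP qr /asboolP rs; apply/asboolP => f Pf; rewrite (le_trans (qr f Pf))// rs.
- have [->|/set0P[q0 Aq0]] := eqVneq A set0; first by exists p1K.
  have bnd f : P f -> has_sup [set sval q f | q in A].
    move=> Pf; split; first by exists (sval q0 f), q0.
    exists (- p1 (- f)) => _ [q Aq <-]; have [sq qp] := proj2_sig q.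
    apply: le_trans (superlinear_leN sq Pf) _; rewrite lerN2.
    by apply: qp; exact: PN.
  pose s f : R := sup [set sval q f | q in A].
  have s_ge f (q : K) : P f -> A q -> sval q f <= s f.
    by move=> Pf Aq; apply: ub_le_sup; [case: (bnd f Pf)|exists q].
  have s_le f a : P f -> (forall q : K, A q -> sval q f <= a) -> s f <= a.
    move=> Pf qa; apply: ge_sup; first by case: (bnd f Pf).
    by move=> _ [q Aq <-]; exact: qa.
  have ss : superlinear s.
    split=> [f h Pf Ph|c f c0 Pf].
      rewrite -lerBrDr; apply: (s_le) => // q Aq; rewrite lerBrDr addrC -lerBrDr.
      apply: (s_le) => // r Ar; rewrite lerBrDr addrC.
      have Pfh := PD Pf Ph.
      have [/asboolP qr|/asboolP rq] := tA _ _ Aq Ar.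
        rewrite (le_trans _ (s_ge _ _ Pfh Ar))//.
        by apply: le_trans ((proj2_sig r).1.1 _ _ Pf Ph); rewrite lerD2r; exact: qr.
      rewrite (le_trans _ (s_ge _ _ Pfh Aq))//.
      by apply: le_trans ((proj2_sig q).1.1 _ _ Pf Ph); rewrite lerD2l; exact: rq.
    rewrite mulrC -ler_pdivlMr//; apply: (s_le) => // q Aq.
    rewrite ler_pdivlMr// mulrC.
    by rewrite (le_trans ((proj2_sig q).1.2 _ _ c0 Pf))// s_ge//; exact: PZ.
  have sp' f : P f -> p1 f <= s f.
    by move=> Pf; rewrite (le_trans _ (s_ge _ _ Pf Aq0))//; exact: (proj2_sig q0).2.
  exists (exist _ s (conj ss sp')) => q Aq; apply/asboolP => f Pf.
  exact: s_ge.
have [sq qp] := proj2_sig q; set L := sval q in sq qp.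
have LN h : P h -> L (- h) = - L h.
  move=> Ph; apply/le_anti; rewrite lerNr (superlinear_leN sq Ph) /=.
  have st := tilt_superlinear sq Ph.
  have tp f : P f -> p1 f <= tilt L h f.
    by move=> Pf; rewrite (le_trans (qp f Pf))// le_tilt.
  pose t : K := exist _ (tilt L h) (conj st tp).
  have qt : le q t by apply/asboolP => f Pf; exact: le_tilt.
  have /asboolP/(_ _ (PN Ph)) := qmax _ qt.
  by apply: le_trans; exact: tiltN.
have LD f h : P f -> P h -> L (f + h) = L f + L h.
  move=> Pf Ph; apply/le_anti; rewrite sq.1// andbT.
  have := sq.1 _ _ (PN Pf) (PN Ph); rewrite -opprD !LN//; last exact: PD.
  lra.
have LZ0 c f : 0 < c -> P f -> L (c *: f) = c * L f.
  move=> c0 Pf; apply/le_anti; rewrite sq.2// andbT.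
  by have := sq.2 _ _ c0 (PN Pf); rewrite scalerN !LN//; [lra|exact: PZ].
exists L; split=> //.
- move=> c f Pf; have [c0|c0|->] := ltgtP c 0.
  + rewrite -[c]opprK scaleNr LN; last exact: PZ.
    by rewrite LZ0 ?oppr_gt0// !mulNr.
  + exact: LZ0.
  + by rewrite scale0r (superlinear0 sq Pf) mul0r.
- by move=> f Pf; rewrite (le_trans _ (qp f Pf))// le_tilt.
apply/le_anti; rewrite (le_trans (le_tilt sp Pg Pg) (qp g Pg)) andbT.
by rewrite -lerN2 -LN// (le_trans (tiltN sp Pg))// qp//; exact: PN.
Qed.

End hahn_banach.

(** * Envelopes and Edwards' theorem *)

Section edwards.
Variables (R : realType) (n : nat).
Local Notation T := (Cn R n).
Local Notation B := (BorelCn R n).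
Implicit Types (X : set T) (f g u : T -> R) (z : T).

Definition minorants X f := [set u | psho X u /\ forall x, X x -> u x <= f x].

Definition envelope X f z : R := sup [set u z | u in minorants X f].

Lemma minorants_has_sup X f z : compact X -> {within X, continuous f} -> X z ->
  has_sup [set u z | u in minorants X f].
Proof.
move=> cX cf Xz; split; last by exists (f z) => _ [u [_ uf] <-]; exact: uf.
have [M M0 fM] := compact_bound cX cf.
exists (- M), (fun=> - M) => //; split; first exact: psho_cst.
by move=> x /fM; rewrite ler_norml => /andP[].
Qed.

Lemma envelope_ge X f z u : compact X -> {within X, continuous f} -> X z ->
  minorants X f u -> u z <= envelope X f z.
Proof.
move=> cX cf Xz uf; apply: ub_le_sup; last by exists u.
by case: (minorants_has_sup cX cf Xz).
Qed.

Lemma envelope_le X f z (a : R) : compact X -> {within X, continuous f} -> X z ->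
  (forall u, minorants X f u -> u z <= a) -> envelope X f z <= a.
Proof.
move=> cX cf Xz ua; apply: ge_sup; first by case: (minorants_has_sup cX cf Xz).
by move=> _ [u uf <-]; exact: ua.
Qed.

Lemma envelope_adherent X f z (a : R) : compact X -> {within X, continuous f} ->
  X z -> a < envelope X f z -> exists2 u, minorants X f u & a < u z.
Proof.
move=> cX cf Xz af.
have e0 : 0 < envelope X f z - a by rewrite subr_gt0.
have [_ [u uf <-]] := sup_adherent e0 (minorants_has_sup cX cf Xz).
by rewrite subKr => au; exists u.
Qed.

(** The envelope is superlinear in the obstacle, so that by the Hahn-Banach
    theorem it is dominated by a linear functional which takes the same value at
    [f]. Being positive this functional is a measure, and that measure is a
    Jensen measure because a function of [psho X] is its own envelope. *)
Theorem edwards X f z : compact X -> {within X, continuous f} -> X z ->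
  exists2 mu : probability B R, jensen X z mu &
    (\int[mu]_(x in X) (f x)%:E = (envelope X f z)%:E)%E.
Proof.
move=> cX cf Xz; pose P : set (T -> R^o) := [set f | {within X, continuous f}].
have PD g h : P g -> P h -> P (g + h).
  by move=> cg ch x; exact: (continuousD (cg x) (ch x)).
have PZ (c : R) g : P g -> P (c *: g).
  move=> cg x.
  have cc : {for x, continuous ((fun=> c) : subspace X -> R)} by exact: cst_continuous.
  exact: (continuousM cc (cg x)).
pose S : (T -> R^o) -> R := fun g => envelope X g z.
have sS : superlinear P S.
  split=> [g h cg ch|c g c0 cg].
    have cgh := PD _ _ cg ch.
    rewrite -lerBrDr; apply: envelope_le => // u [pu ug]; rewrite lerBrDr addrC -lerBrDr.
    apply: envelope_le => // w [pw wh]; rewrite lerBrDr addrC.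
    apply: (@envelope_ge X (g + h) z (fun x => u x + w x)) => //; split.
      exact: psho_add.
    by move=> x Xx; rewrite lerD ?ug ?wh.
  have ccg := PZ c _ cg.
  rewrite mulrC -ler_pdivlMr//; apply: envelope_le => // u [pu ug].
  rewrite ler_pdivlMr// mulrC.
  apply: (@envelope_ge X (c *: g) z (fun x => c * u x)) => //; split.
    by apply: psho_scale => //; exact: ltW.
  by move=> x Xx; rewrite /= ler_wpM2l ?ug// ltW.
have [L [LD LZ SL Lf]] := hahn_banach PD PZ sS cf.
have S_psho u : psho X u -> u z <= S u.
  by move=> pu; apply: envelope_ge => //; exact: psho_within.
have L_ge0 g : P g -> (forall x, X x -> 0 <= g x) -> 0 <= L g.
  move=> cg g0; apply: le_trans (SL _ cg).
  apply: (@envelope_ge X g z (fun=> 0)) => //; split=> //; exact: psho_cst.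
have L1 : L (fun=> 1) = 1.
  have c1 : P (fun=> 1) by exact/psho_within/psho_cst.
  apply/le_anti/andP; split; last by rewrite (le_trans _ (SL _ c1))// S_psho//; exact: psho_cst.
  have : -1 <= S (-1 *: (fun _ : T => 1 : R^o)).
    apply: (@envelope_ge X (-1 *: (fun _ : T => 1 : R^o)) z (fun=> -1)) => //.
      exact: PZ.
    split; first exact: psho_cst.
    move=> x _; have -> : (-1 *: (fun _ : T => 1 : R^o)) x = -1 by exact: mulr1.
    exact: lexx.
  by have := SL _ (PZ (-1) _ c1); rewrite LZ//; lra.
have [mu [muX muL]] := riesz cX LD LZ L_ge0 L1.
exists mu; last by rewrite -muL// Lf.
split=> // u pu; have cu := psho_within pu.
by rewrite -muL// lee_fin (le_trans (S_psho u pu))// SL.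
Qed.

End edwards.

(** * Jensen measures and their supports *)

Section jensen.
Variables (R : realType) (n : nat).
Local Notation T := (Cn R n).
Local Notation B := (BorelCn R n).
Implicit Types (X K D : set T) (mu : probability B R) (z p b x y : T).

Lemma not_lt0_measure mu (U : set B) : ~ (0 < mu U)%E -> mu U = 0%E.
Proof.
move=> h; apply/eqP; move: h; apply: contra_notT => h.
by rewrite lt0e h measure_ge0.
Qed.

Lemma compact_off_supp_null mu K : compact K -> (forall x, K x -> ~ supp mu x) ->
  mu K = 0%E.
Proof.
move=> cK Ks.
have pick x : exists U : set T, K x -> [/\ open U, U x & mu U = 0%E].
  have [Kx|nKx] := pselect (K x); last by exists set0.
  have := Ks x Kx => /existsNP[U /not_implyP[oU /not_implyP[Ux mU]]].
  by exists U => _; split=> //; exact: not_lt0_measure.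
have [U UP] := choice pick.
have cov : K `<=` cover K U by move=> x Kx; exists x => //; case: (UP x Kx).
have oU i : K i -> open (U i) by move=> /UP[].
have := cK; rewrite compact_cover => /(_ _ _ _ oU cov)[D' D'K KD'].
have neg : mu.-negligible (\big[setU/set0]_(i <- D') U i).
  rewrite big_seq; elim/big_ind: _ => [||i iD'].
  - exact: negligible_set0.
  - by move=> *; exact: negligibleU.
  have := D'K i iD'; rewrite inE => /UP[oUi _ mUi].
  by exists (U i); split=> //; exact: open_borel.
have [A [mA A0 sA]] := neg.
apply/eqP; rewrite eq_le measure_ge0 andbT -A0.
apply: le_measure; rewrite ?inE//; first exact: compact_borel.
apply: subset_trans sA => x /KD'[i iD' Uix].
by rewrite -bigcup_fset; exists i.
Qed.

Lemma supp_sub X mu y : closed X -> mu X = 1%E -> supp mu y -> X y.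
Proof.
move=> cX muX; apply: contraPP => nXy /(_ (~` X) (closed_openC cX) nXy).
have mX : measurable (X : set B) by exact: closed_borel.
by rewrite probability_setC// [Z in (_ - Z)%E]muX subee// ltxx.
Qed.

(** The integral of a nonpositive function is strictly negative when the function
    stays below a negative constant on a neighbourhood of a point of the support,
    which upper semicontinuity provides. *)
Lemma jensen_supp_zero X z mu (phi : T -> \bar R) y : compact X -> X z ->
  psh_compact X phi -> (forall x, X x -> (phi x <= 0)%E) -> phi z = 0%E ->
  jensen X z mu -> supp mu y -> phi y = 0%E.
Proof.
move=> cX Xz [uphi pphi] phi0 phiz Jmu sy; have [muX _] := Jmu.
have cl := compact_closed_Cn cX; have mX := closed_borel cl.
have Xy := supp_sub cl muX sy.
apply/eqP; rewrite eq_le phi0//= leNgt; apply/negP => phiy.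
have [c c0 phic] : exists2 c : R, 0 < c & (phi y < (- c)%:E)%E.
  case: (phi y) phiy => [r| |]//.
    by rewrite lte_fin => r0; exists (- r / 2); [|rewrite lte_fin]; lra.
  by move=> _; exists 1; rewrite ?ltr01 ?ltNyr.
have [W oW Wphi] := usc_on_lt_open (- c) uphi.
have mW : measurable (W : set B) by exact: open_borel.
have Wy : W y by apply/(Wphi y Xy).
have := pphi z mu Xz Jmu; rewrite phiz leNgt => /negP; apply.
pose g x := (- phi x)%E.
have mphi : measurable_fun (X : set B) (phi : B -> \bar R) by exact: usc_measurable.
have mg : measurable_fun (X : set B) (g : B -> \bar R).
  exact: measurableT_comp mphi.
have g0 x : X x -> (0 <= g x)%E by move=> /phi0; rewrite leeNr oppe0.
have -> : (\int[mu]_(x in X) phi x = - \int[mu]_(x in X) g x)%E.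
  rewrite -integral_ge0N//; apply: eq_integral => x _; by rewrite /g oppeK.
rewrite oppe_lt0.
apply: (@lt_le_trans _ _ (c%:E * mu W)%E); first by rewrite mule_gt0// sy.
rewrite (measure_full_inter mX mW muX) -(integral_indic mu mX mW) -ge0_integralZl//; first last.
- by rewrite lee_fin ltW.
- exact/measurable_EFinP/measurable_indic.
- apply: ge0_le_integral => //.
  + by move=> x _; rewrite mule_ge0// lee_fin// ltW.
  + apply: measurable_funeM; exact/measurable_EFinP/measurable_indic.
  move=> x Xx; rewrite indicE; case: (boolP (x \in W)) => [|_].
    rewrite inE => /(Wphi x Xx) lt; rewrite mule1 /g leeNr.
    by rewrite -EFinN ltW.
  by rewrite mule0 g0.
Qed.

(** Evaluation of the circle mean is a positive functional, hence a measure,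
    which the mean value inequality turns into a Jensen measure. *)
Lemma circle_jensen X p b : compact X -> in_disc X p b ->
  exists2 mu, jensen X p mu & supp mu (p + b).
Proof.
move=> cX dX; pose L (f : T -> R) := cmean (fun t => f (p + cis t *: b)).
have cont (f : T -> R) : {within X, continuous f} -> continuous (fun t => f (p + cis t *: b)).
  move=> cX' t; have cf := (@within_continuousP R T X f).1 cX'; apply/cvgrPdist_lt => e e0.
  have Xt s : X (p + cis s *: b) by exact: in_disc_cis.
  have h : \forall s \near t, X (p + cis s *: b) ->
      `|f (p + cis s *: b) - f (p + cis t *: b)| < e.
    exact: (@circle_continuous R T p b t _ (cf _ (Xt t) e e0)).
  by apply: filterS h => s h; rewrite distrC h.
have LD (f g : T -> R) : {within X, continuous f} -> {within X, continuous g} ->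
    L (fun x => f x + g x) = L f + L g.
  by move=> cf cg; rewrite /L cmeanD//; exact: cont.
have LZ (c : R) (f : T -> R) : {within X, continuous f} -> L (fun x => c * f x) = c * L f.
  by move=> cf; rewrite /L cmeanZ//; exact: cont.
have L0 (f : T -> R) : {within X, continuous f} -> (forall x, X x -> 0 <= f x) -> 0 <= L f.
  move=> cf f0; rewrite -(cmean_cst (0 : R)); apply: le_cmean.
  - exact: cst_continuous.
  - exact: cont.
  - by move=> t; exact: (f0 _ (in_disc_cis t dX)).
have L1 : L (fun=> 1) = 1 by rewrite /L cmean_cst.
have [mu [muX muL]] := riesz cX LD LZ L0 L1; exists mu.
  split=> // u pu; rewrite -muL; last exact: psho_within pu.
  have /pshoP[U [v [[oU cv sv] XU vu]]] := pu.
  rewrite lee_fin -vu; last exact: in_disc_center dX.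
  rewrite (le_trans (sv _ _ (in_disc_sub XU dX)))// /L.
  suff -> : (fun t => v (p + cis t *: b)) = (fun t => u (p + cis t *: b)) by [].
  by apply/funext => t; rewrite vu//; exact: in_disc_cis.
move=> U oU Ub.
pose f := cdist (~` U); have cf : {within X, continuous f}.
  by apply: continuous_subspaceT; exact: cdist_continuous.
have f1 : 0 < f (p + b).
  by apply: cdist_gt0 => [|//]; exact: open_closedC.
have Lf : 0 < L f.
  have cNf : {within X, continuous (fun x => - f x)}.
    by move=> x; apply: continuousN; exact: cf.
  have -> : L f = - L (fun x => - f x).
    rewrite -mulN1r -LZ//; congr L; apply/funext => x; by rewrite mulrN mulN1r opprK.
  rewrite oppr_gt0 /L; apply: cmean_lt.
  - exact: (cont (fun x => - f x)).
  - by move=> t; rewrite oppr_le0 cdist_ge0.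
  - by rewrite cis0 scale1r oppr_lt0.
have mX := compact_borel cX; have mU := open_borel oU.
rewrite (measure_full_inter mX mU muX) -(integral_indic mu mX mU).
apply: (@lt_le_trans _ _ (L f)%:E); first by rewrite lte_fin.
rewrite muL//; apply: ge0_le_integral => //.
- by move=> x _; rewrite lee_fin cdist_ge0.
- by apply/measurable_EFinP; exact: within_measurable mX cf.
- exact/measurable_EFinP/measurable_indic.
move=> x Xx; rewrite lee_fin indicE; case: (boolP (x \in U)) => [_|].
  exact: cdist_le1.
by rewrite notin_setE => nUx; rewrite /f cdist_in.
Qed.

End jensen.

(** * Barriers and the strong maximum principle *)

Section domains.
Variables (R : realType) (n : nat).
Local Notation T := (Cn R n).
Local Notation B := (BorelCn R n).
Implicit Types (X K D : set T) (mu : probability B R) (z p b x y : T).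

Lemma bounded_closure_compact D : bounded_set D -> compact (closure D).
Proof.
move=> [M [Mr MP]].
have M1 : M < M + 1 by rewrite ltrDl ltr01.
have DC : D `<=` [set y | rnorm (y - 0) <= complex.Re (M + 1)].
  move=> y Dy /=; rewrite subr0.
  by have := MP _ M1 y Dy; rewrite /= rnormE lecE => /andP[].
apply: (@bounded_closed_compact_Cn R n _ (complex.Re (M + 1))).
  exact: closed_closure.
move=> y; have cC := @closed_rball R T 0 (complex.Re (M + 1)).
by move=> /(closureS DC); rewrite -(closure_id _).1// /= subr0.
Qed.

Lemma bdryP D x : open D -> bdry D x <-> closure D x /\ ~ D x.
Proof. by move=> oD; rewrite /bdry (interior_id _).1. Qed.

(** The domain is exhausted by compact sets, which are null because they do not
    meet the support. *)
Lemma supp_bdry_null D mu : open D -> compact (closure D) ->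
  supp mu `<=` bdry D -> mu D = 0%E.
Proof.
move=> oD cX sb.
pose K (m : nat) := closure D `&` [set x | m.+1%:R^-1 <= cdist (~` D) x].
have cK m : compact (K m).
  apply: compact_closedI => //.
  apply: (closed_comp (f := cdist (~` D)) _ (@closed_ge R (m.+1%:R^-1))) => x _.
  exact: cdist_continuous.
have K0 m : mu (K m) = 0%E.
  apply: compact_off_supp_null => // x [_ /= xm] /sb/(bdryP _ oD)[_ nDx].
  by move: xm; rewrite cdist_in// leNgt invr_gt0 ltr0n.
have mK m : measurable (K m : set B) by exact: compact_borel.
have DK : D `<=` \bigcup_m K m.
  move=> x Dx; have d0 : 0 < cdist (~` D) x.
    by apply: cdist_gt0 => [|//]; exact: open_closedC.
  exists (Num.truncn (cdist (~` D) x)^-1) => //; split; first exact: subset_closure.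
  by rewrite /= invf_ple ?posrE// ?ltr0n// ltW// truncnS_gt.
have : mu.-negligible (\bigcup_m K m).
  by apply: negligible_bigcup => m; exists (K m); split=> //; exact: K0.
move=> [A [mA A0 sA]]; apply/eqP; rewrite eq_le measure_ge0 andbT -A0.
by apply: le_measure; rewrite ?inE//; [exact: open_borel|exact: subset_trans sA].
Qed.

(** The zero set of [phi] in the domain is closed by upper semicontinuity. It is
    open because every point near a zero [p] lies in the support of a Jensen
    measure for [p], the mean over a circle. *)
Lemma strong_maximum D (phi : T -> \bar R) x0 : bounded_domain D ->
  psh_compact (closure D) phi -> (forall x, closure D x -> (phi x <= 0)%E) ->
  D x0 -> phi x0 = 0%E -> forall x, closure D x -> phi x = 0%E.
Proof.
move=> [oD coD _ bD] pphi phi0 Dx0 phix0.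
have cX := bounded_closure_compact bD; have DX := @subset_closure _ D.
have [W oW Wphi] := usc_on_lt_open 0 pphi.1.
pose Z := D `&` ~` W.
have ZE x : closure D x -> (~` W) x <-> phi x = 0%E.
  move=> Xx; split=> [nWx|x00 /(Wphi x Xx)]; last by rewrite x00 ltxx.
  apply/eqP; rewrite eq_le phi0//= leNgt; apply/negP => lt.
  by apply: nWx; apply/Wphi.
have oZ : open Z.
  rewrite openE => p [Dp nWp].
  have /nbhs_rnormP[r r0 rD] := open_nbhs_nbhs (conj oD Dp).
  apply/(@nbhs_rnormP R T); exists r => // y yp; split; first exact: rD.
  apply/ZE; first exact/DX/rD.
  have dX : in_disc (closure D) p (y - p).
    move=> l l1; apply/DX/rD; rewrite addrC addKr rnormZ (le_lt_trans _ yp)//.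
    rewrite ler_piMl ?rnorm_ge0//.
    by move: l1; rewrite normc_rnorm -[1]/(1%:C%C) lecR.
  have [mu Jmu] := circle_jensen cX dX; rewrite addrC subrK => sy.
  apply: (jensen_supp_zero cX (DX _ Dp) pphi phi0 _ Jmu sy).
  by apply/ZE => //; exact: DX.
have ZD : Z = D.
  apply: coD.
  - by exists x0; split=> //; apply/ZE => //; exact: DX.
  - by exists Z => //; rewrite /Z setIA setIid.
  - by exists (~` W) => //; exact: open_closedC.
move=> x Xx; apply/(ZE x Xx) => Wx.
have [y [Dy Wy]] := Xx W (open_nbhs_nbhs (conj oW Wx)).
by have [] : Z y by rewrite ZD.
Qed.

(** The largest value of the defining function of a P-hyperconvex domain is
    attained on the boundary, where it is zero. *)
Lemma P_hyperconvex_barrier D : P_hyperconvex D ->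
  exists phi : T -> \bar R,
    [/\ psh_compact (closure D) phi, exists x, closure D x /\ phi x != 0%E,
        forall x, closure D x -> (phi x <= 0)%E
      & forall z, bdry D z -> phi z = 0%E].
Proof.
move=> [bD [phi [[x [y [Xx Xy xy]]] [uphi pphi] cphi phi0]]].
have [oD coD D0 bbD] := bD; have cX := bounded_closure_compact bbD.
have X0 : closure D !=set0 by exists x.
have [a /set_mem Xa amax] := compact_EVT_max X0 cX cphi.
have {}amax t : closure D t -> phi t <= phi a by move=> Xt; exact/amax/mem_set.
have ba : bdry D a.
  apply/bdryP => //; split=> // Da.
  pose psi t := phi t - phi a.
  have cpsi : {within closure D, continuous psi}.
    by move=> t; apply: (continuousD (cphi t)); exact: cst_continuous.
  have ppsi : psh_compact (closure D) (EFin \o psi).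
    split=> [|z mu Xz Jmu]; first exact: usc_on_continuous.
    have := pphi z mu Xz Jmu.
    have int (f : T -> R) : {within closure D, continuous f} ->
      mu.-integrable (closure D : set B) (EFin \o f) by exact: within_integrable.
    have cc : {within closure D, continuous (fun _ : T => - phi a)}.
      by apply: continuous_subspaceT; exact: cst_continuous.
    have -> : (\int[mu]_(x in closure D) (EFin \o psi) x =
        \int[mu]_(x in closure D) (EFin \o phi) x - (phi a)%:E)%E.
      rewrite (@integralD_EFin _ _ _ mu _ (compact_borel cX) phi (fun=> - phi a)).
      - congr (_ + _)%E; rewrite /= integral_cst; last exact: compact_borel.
        by case: Jmu => /= -> _; rewrite mule1.
      - exact: (int _ cphi).
      - exact: (int _ cc).
    by move=> h; rewrite /= EFinB leeD2r.
  have psi0 t : closure D t -> ((EFin \o psi) t <= 0)%E.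
    by move=> Xt; rewrite lee_fin subr_le0 amax.
  have psia : (EFin \o psi) a = 0%E by rewrite /= /psi subrr.
  have Z := strong_maximum bD ppsi psi0 Da psia.
  move: xy; suff -> : phi x = phi y by rewrite eqxx.
  by have [] := Z x Xx; have [] := Z y Xy; rewrite /psi; lra.
have a0 := phi0 a ba.
exists (EFin \o phi); split.
- by split.
- have [x0|x0] := eqVneq (phi x) 0; last by exists x; split=> //; rewrite eqe.
  by exists y; split=> //; rewrite eqe; rewrite x0 eq_sym in xy.
- by move=> t Xt; rewrite lee_fin -a0 amax.
- by move=> z /phi0 /= ->.
Qed.

(** A barrier at [z] vanishes on the support of the Jensen measures for [z]; if it
    vanished inside the domain it would vanish identically. *)
Lemma barrier_supp_bdry D z mu (phi : T -> \bar R) : bounded_domain D ->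
  psh_compact (closure D) phi -> (exists x, closure D x /\ phi x != 0%E) ->
  (forall x, closure D x -> (phi x <= 0)%E) -> phi z = 0%E ->
  bdry D z -> jensen (closure D) z mu -> supp mu `<=` bdry D.
Proof.
move=> bD pphi [x [Xx phix]] phi0 phiz bz Jmu y sy.
have [oD _ _ bbD] := bD; have cX := bounded_closure_compact bbD.
have Xz : closure D z by case: bz.
have Xy := supp_sub (compact_closed_Cn cX) (Jmu.1) sy.
apply/bdryP => //; split=> // Dy.
have phiy := jensen_supp_zero cX Xz pphi phi0 phiz Jmu sy.
by move: phix; rewrite (strong_maximum bD pphi phi0 Dy phiy Xx) eqxx.
Qed.

(** When no Jensen measure of a boundary point charges the domain, minus the
    indicator function of the domain is plurisubharmonic on the closure. *)
Lemma supp_bdry_barrier D : bounded_domain D ->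
  (forall z mu, bdry D z -> jensen (closure D) z mu -> supp mu `<=` bdry D) ->
  let phi x : \bar R := if x \in D then (-1)%E else 0%E in
  psh_compact (closure D) phi.
Proof.
move=> [oD _ _ bD] Dsupp phi; have cX := bounded_closure_compact bD.
have mX := compact_borel cX; have mD := open_borel oD.
have Nphi x : (- phi x)%E = (if x \in D then 1 else 0)%:E.
  by rewrite /phi; case: ifP; rewrite ?oppe0// -EFinN opprK.
split.
  split=> [x _|]; first by rewrite /phi; case: ifP => _; rewrite ?ltry.
  apply/lower_semicontinuousP => a; apply: open_subspaceW.
  have [a0|a0] := ltP a 0.
    rewrite (_ : [set x | _] = setT); first exact: openT.
    apply/seteqP; split=> x //= _; rewrite Nphi lte_fin (lt_le_trans a0)//.
    by case: ifP.
  have [a1|a1] := ltP a 1.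
    rewrite (_ : [set x | _] = D)//; apply/seteqP; split=> x /=; rewrite Nphi lte_fin.
      by case: ifP => [/set_mem//|_]; rewrite ltNge a0.
    by move=> Dx; rewrite mem_set.
  rewrite (_ : [set x | _] = set0); first exact: open0.
  apply/seteqP; split=> x //=; rewrite Nphi lte_fin ltNge => /negP[].
  by rewrite (le_trans _ a1)//; case: ifP.
move=> z mu Xz Jmu.
have -> : (\int[mu]_(x in closure D) phi x = - mu D)%E.
  rewrite (measure_full_inter mX mD Jmu.1) -(integral_indic mu mX mD).
  rewrite -integral_ge0N; last by move=> x _; rewrite lee_fin.
  apply: eq_integral => x _; rewrite -[LHS]oppeK Nphi indicE.
  by case: (x \in D).
rewrite /phi; case: (boolP (z \in D)) => [_|].
  by rewrite leeN2 probability_le1.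
rewrite notin_setE => nDz.
have bz : bdry D z by apply/bdryP.
by rewrite (supp_bdry_null oD cX (Dsupp z mu bz Jmu)) oppe0.
Qed.

End domains.

(** * Minorants of obstacles that vanish on the boundary *)

Section hyperconvex.
Variables (R : realType) (n : nat).
Local Notation T := (Cn R n).
Local Notation B := (BorelCn R n).
Implicit Types (X K D U : set T) (mu : probability B R) (u v w g : T -> R) (z x y : T).

Definition jensen_supp_bdry D := forall z mu, bdry D z ->
  jensen (closure D) z mu -> supp mu `<=` bdry D.

Lemma bdry_compact D : open D -> compact (closure D) -> compact (bdry D).
Proof.
move=> oD cX; rewrite /bdry (interior_id _).1// setDE.
by apply: compact_closedI => //; exact: open_closedC.
Qed.

(** The envelope is the integral of [g] for some Jensen measure, and that measure
    is carried by the boundary. *)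
Lemma bdry_envelope0 D g z : bounded_domain D -> jensen_supp_bdry D ->
  {within closure D, continuous g} -> (forall x, bdry D x -> g x = 0) ->
  bdry D z -> envelope (closure D) g z = 0.
Proof.
move=> [oD _ _ bD] sD cg g0 bz; have cX := bounded_closure_compact bD.
have Xz : closure D z by case: bz.
have [mu Jmu gmu] := edwards cX cg Xz.
apply/eqP; rewrite -eqe -gmu.
have mX := compact_borel cX; have mD := open_borel oD.
have muD := supp_bdry_null oD cX (sD z mu bz Jmu).
rewrite (negligible_integral mD mX _ muD); last exact: within_integrable.
rewrite (eq_integral (fun=> 0%E)) ?integral0// => x /set_mem[Xx nDx].
by have /= -> := g0 x ((bdryP x oD).2 (conj Xx nDx)).
Qed.

(** By Edwards' theorem the envelope of such an obstacle vanishes on the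
    boundary; by compactness finitely many minorants suffice. *)
Lemma boundary_minorant D g (e : R) : bounded_domain D -> jensen_supp_bdry D ->
  {within closure D, continuous g} -> (forall x, bdry D x -> g x = 0) -> 0 < e ->
  exists2 u, minorants (closure D) g u & forall z, bdry D z -> - e < u z.
Proof.
move=> bD sD cg g0 e0; have [oD _ _ bbD] := bD.
have cX := bounded_closure_compact bbD.
have pick z : exists uW : (T -> R) * set T, bdry D z ->
    [/\ minorants (closure D) g uW.1, open uW.2, uW.2 z &
        forall x, closure D x -> uW.2 x -> - e < uW.1 x].
  have [bz|nbz] := pselect (bdry D z); last by exists (g, set0).
  have Xz : closure D z by case: bz.
  have [|u mu uz] := @envelope_adherent R n (closure D) g z (- e) cX cg Xz.
    by rewrite (bdry_envelope0 bD sD cg g0 bz) oppr_lt0.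
  have [W oW Wu] := continuous_gt_open (- e) (psho_within mu.1).
  exists (u, W) => _; split=> //=; first exact/(Wu z Xz).
  by move=> x Xx /(Wu x Xx).
have [F FP] := choice pick.
have cov : bdry D `<=` cover (bdry D) (fun z => (F z).2).
  by move=> z bz; exists z => //; have [] := FP z bz.
have oF z : bdry D z -> open (F z).2 by move=> /FP[].
have := bdry_compact oD cX; rewrite compact_cover => /(_ _ _ _ oF cov)[D' D'b bD'].
have [M M0 gM] := compact_bound cX cg.
have list (l : seq T) : (forall i, i \in l -> bdry D i) ->
    exists2 u, minorants (closure D) g u &
      forall x, closure D x -> (exists2 i, i \in l & (F i).2 x) -> - e < u x.
  elim: l => [|i l IH] il.
    exists (fun=> - M); last by move=> x _ [].
    split; first exact: psho_cst.
    by move=> x /gM; rewrite ler_norml => /andP[].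
  have [u [pu ug] ul] := IH (fun j jl => il j (mem_behead (s := i :: l) jl)).
  have [[pi gi] _ _ iW] := FP i (il i (mem_head _ _)).
  exists (fun x => Num.max (u x) ((F i).1 x)).
    split; first exact: psho_max.
    by move=> x Xx; rewrite ge_max ug//= gi.
  move=> x Xx [j]; rewrite inE => /orP[/eqP ->|jl] Fx; rewrite lt_max.
    by rewrite iW ?orbT.
  by rewrite ul//; exists j.
have [|u mu ul] := list (enum_fset D').
  by move=> i /D'b; rewrite inE.
exists u => // z bz; apply: ul; first by case: bz.
by have [i iD' Fi] := bD' z bz; exists i.
Qed.

Lemma cpsh_lt_open U W v w : cpsh U v -> cpsh W w ->
  open [set y | [/\ U y, W y & v y < w y]].
Proof.
move=> [oU cv _] [oW cw _]; rewrite openE => x [Ux Wx vw].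
have e0 : 0 < (w x - v x) / 2 by rewrite divr_gt0// subr_gt0.
have [a a0 aP] := (@continuous_rnormP R T v x).1 (cv x Ux) _ e0.
have [b b0 bP] := (@continuous_rnormP R T w x).1 (cw x Wx) _ e0.
have /nbhs_rnormP[c c0 cP] := open_nbhs_nbhs (conj (openI oU oW) (conj Ux Wx)).
apply/(@nbhs_rnormP R T); exists (Num.min a (Num.min b c)).
  by rewrite !lt_min a0 b0.
move=> y; rewrite !lt_min => /and3P[ya yb yc]; have [Uy Wy] := cP y yc.
split=> //; have := aP y ya; have := bP y yb.
by rewrite !ltr_distl => /andP[h1 h2] /andP[h3 h4]; lra.
Qed.

(** A real line through a point of the domain would otherwise be contained in
    it by connectedness, although the domain is bounded. *)
Lemma bdry_nonempty D : (0 < n)%N -> bounded_domain D -> bdry D !=set0.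
Proof.
move=> n0 [oD _ [x Dx] bD]; apply: contrapT => bD0.
have Dcl y : closure D y -> D y.
  by move=> Xy; apply: contrapT => nDy; apply: bD0; exists y; apply/bdryP.
have cX := bounded_closure_compact bD.
have [M M0 DM] : exists2 M, 0 < M & forall y, D y -> rnorm y <= M.
  have [M M0 MP] := compact_bound cX (continuous_subspaceT (@rnorm_continuous R T)).
  exists M => // y Dy; have := MP y (subset_closure Dy).
  by rewrite ger0_norm ?rnorm_ge0.
pose b : T := const_mx 1.
have b1 : 1 <= rnorm b.
  apply: le_trans (rnorm_coord b (Ordinal n0)); rewrite mxE.
  by rewrite /rnorm normr1.
pose f (t : R) : T := x + t%:C%C *: b.
have cf : continuous f.
  move=> t; apply: (@continuous_comp _ _ _ (fun t : R => t%:C%C : R[i]^o) (fun l : R[i]^o => x + l *: b)).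
    move=> A /nbhs_rnormP[r r0 rA]; exists r => // s /= ts.
    apply: rA; rewrite -rmorphB /rnorm normc_def /= expr0n addr0 sqrtr_sqr.
    by rewrite distrC.
  exact: line_continuous.
have : [set t | D (f t)] = setT.
  have /connected_intervalP cR : is_interval (@setT R) by [].
  apply: cR.
  - by exists 0; rewrite /f /= scale0r addr0.
  - exists (f @^-1` D); last by rewrite setTI.
    by move/continuousP: cf; exact.
  - exists (f @^-1` D); last by rewrite setTI.
    have cD : closed D by move=> y /Dcl.
    exact: closed_comp cD.
move=> /seteqP[_ /(_ (M + rnorm x + 1) I)] /= /DM.
pose t := M + rnorm x + 1; rewrite -/t => ft.
have : rnorm (t%:C%C *: b) <= rnorm (f t) + rnorm x.
  by have := ler_rnormD (f t) (- x); rewrite rnormN /f [x + _]addrC addrK.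
have p : 0 <= t by rewrite !addr_ge0 ?rnorm_ge0// ltW.
rewrite rnormZ ger0_norm ?lecR//=.
have : t <= t * rnorm b by rewrite ler_peMr.
have tE : t = M + rnorm x + 1 by [].
by move: ft; lra.
Qed.

End hyperconvex.

(** * Construction of the defining function *)

Section walsh.
Variables (R : realType) (n : nat).
Local Notation T := (Cn R n).
Local Notation B := (BorelCn R n).
Implicit Types (X K D U : set T) (mu : probability B R) (u v w g : T -> R) (h x y : T).

Lemma compact_sublevel X u (a : R) : compact X -> {within X, continuous u} ->
  compact [set x | X x /\ u x <= a].
Proof.
move=> cX cu; have [W oW Wu] := continuous_gt_open a cu.
have -> : [set x | X x /\ u x <= a] = X `&` ~` W.
  apply/seteqP; split=> x [Xx].
    by move=> ux; split=> // /(Wu x Xx); rewrite ltNge ux.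
  by move=> nWx; split=> //; rewrite leNgt; apply/negP => /(Wu x Xx).
by apply: compact_closedI => //; exact: open_closedC.
Qed.

Lemma compact_open_margin K D : compact K -> open D -> K `<=` D ->
  exists2 d : R, 0 < d & forall x h, K x -> rnorm h < d -> D (x + h).
Proof.
move=> cK oD KD; have [->|/set0P K0] := eqVneq K set0; first by exists 1.
have cc := @cdist_continuous R n (~` D).
have [a /set_mem Ka amin] := compact_EVT_min K0 cK (continuous_subspaceT cc).
exists (cdist (~` D) a).
  by apply: cdist_gt0; [exact: open_closedC|move=> /(_ (KD a Ka))].
move=> x h Kx hd; apply: contrapT => nD.
have := @cdist_le R n (~` D) x (x + h) nD.
rewrite opprD addrA subrr add0r rnormN leNgt => /negP; apply.
by apply: lt_le_trans hd _; exact: amin (mem_set Kx).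
Qed.

(** Walsh's translation argument: a minorant [u'] translated by a small [h] and
    lowered by [2 * e] is glued to [u] along the set where [u = - e]. There [u]
    is the larger of the two, since [u' <= 0]. *)
Lemma glue_translate D u u' h (e : R) : open D ->
  psho (closure D) u -> psho (closure D) u' -> (forall x, closure D x -> u' x <= 0) ->
  0 < e -> (forall x, closure D x -> u x <= - e -> D x /\ D (x + h)) ->
  psho (closure D) (fun x => if `[< closure D x /\ u x <= - e >]
                             then Num.max (u x) (u' (x + h) - 2 * e) else u x).
Proof.
move=> oD /pshoP[U [v [pv XU vu]]] /pshoP[U' [v' [pv' XU' vu']]] u'0 e0 hD.
have DX := @subset_closure _ D.
pose w x := v' (x + h) - 2 * e.
have pw : cpsh [set x | U' (x + h)] w.
  apply: cpsh_add; first exact: cpsh_translate.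
  by apply: cpsh_cst; case: (cpsh_translate h pv').
have pc : cpsh setT (fun _ : T => - e) by apply: cpsh_cst; exact: openT.
pose V x := if `[< closure D x /\ u x <= - e >] then Num.max (v x) (w x) else v x.
have pV : psho (closure D) V.
  apply: psho_local => x Xx.
  have [ux|ux|ux] := ltgtP (u x) (- e).
  - have [Dx Dxh] := hD x Xx (ltW ux).
    pose G := [set y | [/\ U y, setT y & v y < - e]] `&` (D `&` [set x | U' (x + h)]).
    have oG : open G.
      apply: openI; first exact: cpsh_lt_open.
      by apply: openI => //; case: pw.
    exists G, (fun x => Num.max (v x) (w x)); split.
    + split; first by split=> //; [exact: XU|rewrite (vu x Xx)].
      by split=> //; exact/XU'/DX.
    + apply: cpsh_max; first by apply: cpsh_sub pv => // y [[]].
      by apply: cpsh_sub pw => // y [_ []].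
    + move=> y [[_ _ vy] [Dy _]]; have Xy := DX y Dy.
      have uy : u y <= - e by rewrite -(vu y Xy) ltW.
      by rewrite /V (asboolT (conj Xy uy)).
  - pose G := [set y | [/\ setT y, U y & - e < v y]].
    have oG : open G by exact: cpsh_lt_open.
    exists G, v; split.
    + by split=> //; [exact: XU|rewrite (vu x Xx)].
    + by apply: cpsh_sub pv => // y [].
    + move=> y [_ Uy vy]; have nK : ~ (closure D y /\ u y <= - e).
        by move=> [Xy]; rewrite -(vu y Xy) leNgt vy.
      by rewrite /V (asboolF nK).
  - have uxe : u x <= - e by rewrite ux.
    have [Dx Dxh] := hD x Xx uxe.
    pose G := [set y | [/\ U' (y + h), U y & w y < v y]].
    have oG : open G by exact: cpsh_lt_open.
    exists G, v; split.
    + split; [exact/XU'/DX|exact: XU|].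
      have := u'0 _ (DX _ Dxh).
      by rewrite /w (vu' _ (DX _ Dxh)) (vu x Xx) ux; lra.
    + by apply: cpsh_sub pv => // y [].
    + by move=> y [_ _ wv]; rewrite /V; case: ifP => // _; rewrite max_l// ltW.
have /pshoP[W [V' [pV' XW VV]]] := pV.
apply/pshoP; exists W, V'; split=> // x Xx; rewrite VV// /V.
case: ifP => [/asboolP[_ ux]|_]; last exact: vu.
have [Dx Dxh] := hD x Xx ux.
by rewrite (vu x Xx) /w (vu' _ (DX _ Dxh)).
Qed.

(** The envelope of minus the capped distance to the complement of the domain:
    it vanishes on the boundary by Edwards' theorem, and a translation argument
    shows that it is continuous. *)
Theorem jensen_supp_bdry_P_hyperconvex D : (0 < n)%N -> bounded_domain D ->
  jensen_supp_bdry D -> P_hyperconvex D.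
Proof.
move=> n0 bD sD; split=> //; have [oD _ [x0 Dx0] bbD] := bD.
have cX := bounded_closure_compact bbD; have DX := @subset_closure _ D.
pose g x := - cdist (~` D) x.
have cg : {within closure D, continuous g}.
  by apply: continuous_subspaceT => x; apply: continuousN; exact: cdist_continuous.
have g0 x : bdry D x -> g x = 0.
  by move=> /(bdryP _ oD)[_ nDx]; rewrite /g cdist_in ?oppr0.
have g_le0 x : g x <= 0 by rewrite oppr_le0 cdist_ge0.
have g_lip x h : g (x + h) <= g x + rnorm h.
  have := cdist_lip (~` D) x (x + h); rewrite opprD addrA subrr add0r rnormN.
  by rewrite /g; lra.
pose phi := envelope (closure D) g.
have phi_g x : closure D x -> phi x <= g x.
  by move=> Xx; apply: envelope_le => // u [_]; exact.
have phi0 z : bdry D z -> phi z = 0 by move=> bz; exact: bdry_envelope0.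
have phi_unif e : 0 < e -> exists2 d, 0 < d & forall x y, closure D x ->
    closure D y -> rnorm (y - x) < d -> phi y <= phi x + 2 * e.
  move=> e0; have [u [pu ug] ue] := boundary_minorant bD sD cg g0 e0.
  pose K := [set x | closure D x /\ u x <= - e].
  have cK : compact K by apply: compact_sublevel => //; exact: psho_within.
  have KD : K `<=` D.
    move=> x [Xx ux]; apply: contrapT => nDx.
    by have := ue x ((bdryP x oD).2 (conj Xx nDx)); rewrite ltNge ux.
  have [d d0 dP] := compact_open_margin cK oD KD.
  exists (Num.min d e) => [|x y Xx Xy]; first by rewrite lt_min d0.
  set h := y - x; rewrite lt_min => /andP[hd he].
  have xhy : x + h = y by rewrite /h addrC subrK.
  apply: envelope_le => // u' [pu' u'g].
  have [ux|ux] := ltP (- e) (u x).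
    have := u'g y Xy; have := g_le0 y.
    have : u x <= phi x by exact: envelope_ge.
    lra.
  have u'0 t : closure D t -> u' t <= 0.
    by move=> Xt; rewrite (le_trans (u'g t Xt)).
  have hD t : closure D t -> u t <= - e -> D t /\ D (t + h).
    by move=> Xt ut; split; [exact: KD|exact: dP].
  have pV := glue_translate oD pu pu' u'0 e0 hD.
  set V := (fun x => if _ then _ else _) in pV.
  have mV : minorants (closure D) g V.
    split=> // t Xt; rewrite /V; case: ifP => [/asboolP[_ ut]|_]; last exact: ug.
    rewrite ge_max ug//=; have [_ Dth] := hD t Xt ut.
    by have := u'g _ (DX _ Dth); have := g_lip t h; lra.
  have := envelope_ge cX cg Xx mV.
  rewrite {1}/V (asboolT (conj Xx ux)) xhy -/phi; apply: contraTT; rewrite -!ltNge => lt.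
  by rewrite lt_max; apply/orP; right; lra.
have cphi : {within closure D, continuous phi}.
  apply/within_continuousP => x Xx e e0.
  have e20 : 0 < e / 4 by rewrite divr_gt0.
  have [d d0 dP] := phi_unif _ e20.
  apply/(@nbhs_rnormP R T); exists d => // y yx Xy.
  have := dP x y Xx Xy yx; have := dP y x Xy Xx; rewrite rdistC => /(_ yx).
  by rewrite ltr_distl => h1 h2; apply/andP; split; lra.
exists phi; split=> //.
- have [y by_] := bdry_nonempty n0 bD.
  exists x0, y; split; [exact: DX|by case: by_|].
  have lt : phi x0 < 0.
    apply: le_lt_trans (phi_g x0 (DX _ Dx0)) _; rewrite oppr_lt0.
    by apply: cdist_gt0; [exact: open_closedC|move=> /(_ Dx0)].
  by rewrite (phi0 y by_) lt_eqF.
split=> [|z mu Xz Jmu]; first exact: usc_on_continuous.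
have int (f : T -> R) : {within closure D, continuous f} ->
  mu.-integrable (closure D : set B) (EFin \o f) by exact: within_integrable.
have mX := compact_borel cX.
rewrite /= -[leRHS]fineK; last exact: (integrable_fin_num mX (int _ cphi)).
rewrite lee_fin; apply: envelope_le => // u mu_; have [pu ug] := mu_.
have cu := psho_within pu.
rewrite -lee_fin fineK; last exact: (integrable_fin_num mX (int _ cphi)).
apply: le_trans (Jmu.2 u pu) _.
apply: (le_integral mX (int _ cu) (int _ cphi)) => x /set_mem Xx.
by rewrite lee_fin; exact: envelope_ge.
Qed.

End walsh.

(** * Quadratic functions *)

Section quadratic.
Variables (R : realType) (n : nat).
Local Notation T := (Cn R n).
Implicit Types (x y z p b : T).

(** The square of the Euclidean norm, whose means over circles are explicit. *)
Definition sqnorm x : R :=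
  \sum_i (complex.Re (x ord0 i) ^+ 2 + complex.Im (x ord0 i) ^+ 2).

Lemma sqnorm_circle p b : exists c1 c2, forall t,
  sqnorm (p + cis t *: b) = sqnorm p + sqnorm b + (c1 * cos t + c2 * sin t).
Proof.
pose re (x : T) i := complex.Re (x ord0 i); pose im (x : T) i := complex.Im (x ord0 i).
exists (\sum_i 2 * (re p i * re b i + im p i * im b i)).
exists (\sum_i 2 * (im p i * re b i - re p i * im b i)) => t.
rewrite /sqnorm !mulr_suml -!big_split /=; apply: eq_bigr => i _.
rewrite /re /im !mxE; case: (p ord0 i) => a a'; case: (b ord0 i) => c c' /=.
have := cos2Dsin2 t; move: (cos t) (sin t) => C S CS.
apply/eqP; rewrite -subr_eq0; apply/eqP.
transitivity ((c ^+ 2 + c' ^+ 2) * (C ^+ 2 + S ^+ 2 - 1)); first by ring.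
by rewrite CS subrr mulr0.
Qed.

Lemma sqnorm_continuous : continuous sqnorm.
Proof.
move=> x; apply: continuous_sum_for => i.
have lip (f : R[i] -> R) : (forall c d, f (c - d) = f c - f d) ->
    (forall c, `|f c| <= rnorm (c : R[i]^o)) ->
    continuous (fun y : T => f (y ord0 i) ^+ 2).
  move=> fB fn.
  have -> : (fun y : T => f (y ord0 i) ^+ 2) = (fun y => f (y ord0 i) * f (y ord0 i)).
    by apply/funext => y; rewrite expr2.
  move=> y; have cf : {for y, continuous (fun y : T => f (y ord0 i))}.
    apply/(@continuous_rnormP R T) => e e0; exists e => // w wy.
    rewrite -fB (le_lt_trans (fn _))// (le_lt_trans _ wy)//.
    by have := rnorm_coord (w - y) i; rewrite !mxE.
  exact: (continuousM cf cf).
have cRe := lip (@complex.Re R) _ _ x; have cIm := lip (@complex.Im R) _ _ x.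
apply: (continuousD (cRe _ _) (cIm _ _)).
- by move=> [? ?] [? ?].
- by move=> c; rewrite -lecR -normc_rnorm; exact: normc_ge_Re.
- by move=> [? ?] [? ?].
- move=> [c d] /=; rewrite /rnorm normc_def /= -sqrtr_sqr ler_sqrt ?addr_ge0 ?sqr_ge0//.
  by rewrite lerDr sqr_ge0.
Qed.

Lemma sqnorm_ge x : rnorm x ^+ 2 <= sqnorm x.
Proof.
have coord i : rnorm (x ord0 i : R[i]^o) ^+ 2 =
    complex.Re (x ord0 i) ^+ 2 + complex.Im (x ord0 i) ^+ 2.
  by rewrite /rnorm normc_def /= sqr_sqrtr// addr_ge0 ?sqr_ge0.
have ge0 i : 0 <= complex.Re (x ord0 i) ^+ 2 + complex.Im (x ord0 i) ^+ 2.
  by rewrite addr_ge0 ?sqr_ge0.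
have [x0|x0] := eqVneq (mx_norm x) 0.
  by rewrite /rnorm /Num.norm /= x0 /= expr0n /= sumr_ge0.
have [[i j] /= xij] := mx_norm_neq0 x0.
have -> : rnorm x = rnorm (x ord0 j : R[i]^o).
  by rewrite /rnorm {1}/Num.norm /= xij (ord1 i).
by rewrite coord /sqnorm (bigD1 j)//= lerDl sumr_ge0.
Qed.

Lemma sqnorm_le x : sqnorm x <= n%:R * rnorm x ^+ 2.
Proof.
rewrite -[n in n%:R]card_ord mulr_natl -sumr_const; apply: ler_sum => i _.
have -> : complex.Re (x ord0 i) ^+ 2 + complex.Im (x ord0 i) ^+ 2 =
    rnorm (x ord0 i : R[i]^o) ^+ 2.
  by rewrite /rnorm normc_def /= sqr_sqrtr// addr_ge0 ?sqr_ge0.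
by rewrite ler_sqr ?nnegrE ?rnorm_ge0// rnorm_coord.
Qed.

Lemma sqnorm_ge0 x : 0 <= sqnorm x.
Proof. by apply: sumr_ge0 => i _; rewrite addr_ge0 ?sqr_ge0. Qed.

(** The mean of [sqnorm (x - z)] over a circle of radius vector [b] exceeds its
    value at the centre by [sqnorm b], whatever [z] is. *)
Lemma cpsh_quadratic (M A : R) z : 0 <= A <= M ->
  cpsh setT (fun x => M * sqnorm x - A * sqnorm (x - z)).
Proof.
move=> /andP[A0 AM]; split=> [|x _|p b _]; first exact: openT.
  have c1 : {for x, continuous (fun x => M * sqnorm x)}.
    have cM : {for x, continuous (fun _ : T => M)} by exact: cst_continuous.
    exact: (continuousM cM (@sqnorm_continuous x)).
  have ct : {for x, continuous (fun x => sqnorm (x - z))}.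
    apply: (@continuous_comp _ _ _ (fun x : T => x - z) sqnorm).
      apply: (@continuous_rnormD R T T) => u v.
      by rewrite opprD addrACA subrr addr0.
    exact: sqnorm_continuous.
  have c2 : {for x, continuous (fun x => A * sqnorm (x - z))}.
    have cA : {for x, continuous (fun _ : T => A)} by exact: cst_continuous.
    exact: (continuousM cA ct).
  exact: (continuousB c1 c2).
have [a [a' ha]] := sqnorm_circle p b.
have [d [d' hd]] := sqnorm_circle (p - z) b.
pose k := M * (sqnorm p + sqnorm b) - A * (sqnorm (p - z) + sqnorm b).
have -> : (fun t => M * sqnorm (p + cis t *: b) - A * sqnorm (p + cis t *: b - z)) =
    (fun t => k + ((M * a - A * d) * cos t + (M * a' - A * d') * sin t)).
  apply/funext => t; rewrite [p + _ - z]addrAC ha hd /k; ring.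
rewrite cmeanD; last 2 first.
- exact: cst_continuous.
- move=> t; have cc c : {for t, continuous (fun _ : R => c : R)} by exact: cst_continuous.
  exact: (continuousD (continuousM (cc _) (@continuous_cos R t))
    (continuousM (cc _) (@continuous_sin R t))).
rewrite cmean_cst cmean_trig addr0 /k.
have MA : 0 <= M - A by rewrite subr_ge0.
by have := mulr_ge0 MA (sqnorm_ge0 b); lra.
Qed.

End quadratic.

(** * Bumps at the boundary and their gluing *)

Section near_seq.
Variables (S : topologicalType) (I : eqType).

Lemma near_seq (l : seq I) (x : S) (Q : I -> S -> Prop) :
  (forall z, z \in l -> nbhs x (Q z)) ->
  nbhs x [set y | forall z, z \in l -> Q z y].
Proof.
elim: l => [_|z l IH lQ]; first by apply: filterS (filterT : nbhs x setT).
have Qz := lQ z (mem_head _ _).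
have Ql := IH (fun k kl => lQ k (mem_behead (s := z :: l) kl)).
by apply: filterS (filterI Qz Ql) => y [yz yl] k; rewrite inE => /orP[/eqP ->|/yl].
Qed.

End near_seq.

Section localization.
Variables (R : realType) (n : nat).
Local Notation T := (Cn R n).
Local Notation B := (BorelCn R n).
Implicit Types (X Y K D U F : set T) (mu : probability B R) (u v w g : T -> R) (x y z k : T).

Lemma P_hyperconvex_supp_bdry D : P_hyperconvex D -> jensen_supp_bdry D.
Proof.
move=> hD z mu bz Jmu.
have [phi [pphi phi1 phi0 phib]] := P_hyperconvex_barrier hD.
exact: (barrier_supp_bdry hD.1 pphi phi1 phi0 (phib z bz) bz Jmu).
Qed.

(** The bump is the positive part of [1 + u] for a minorant [u] of a multiple of
    minus the distance to the boundary of [D], the multiple being so large that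
    the obstacle is at most [- 1] on [Y] off [W]. *)
Lemma local_bump D Y F (W : set T) (e : R) : P_hyperconvex D -> compact Y ->
  Y `<=` closure D -> (forall x, Y x -> ~ F x -> D x) ->
  (forall x, Y x -> F x -> bdry D x) -> open W -> F `<=` W -> 0 < e ->
  exists h : T -> R, [/\ psho Y h, forall x, Y x -> 0 <= h x <= 1,
    forall x, Y x -> ~ W x -> h x = 0 & forall x, Y x -> F x -> 1 - e <= h x].
Proof.
move=> hD cY YD YnF YF oW FW e0; have [bD _] := hD; have [oD _ _ bbD] := bD.
have cX := bounded_closure_compact bbD; have cb := bdry_compact oD cX.
pose K := Y `&` ~` W; have cK : compact K.
  by apply: compact_closedI => //; exact: open_closedC.
pose d := cdist (bdry D); have cd : continuous d by exact: cdist_continuous.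
have [c c0 dc] : exists2 c : R, 0 < c & forall x, K x -> c <= d x.
  have [->|/set0P K0] := eqVneq K set0; first by exists 1.
  have [a /set_mem [Ya nWa] amin] := compact_EVT_min K0 cK (continuous_subspaceT cd).
  exists (d a); last by move=> x Kx; apply: amin; exact/mem_set.
  apply: cdist_gt0; first exact: compact_closed_Cn.
  by move=> /(bdryP _ oD)[_]; apply; apply: YnF => // /FW.
pose g x := - c^-1 * d x.
have c'0 : 0 < c^-1 by rewrite invr_gt0.
have cg : {within closure D, continuous g}.
  apply: continuous_subspaceT => x.
  have cc : {for x, continuous (fun _ : T => - c^-1)} by exact: cst_continuous.
  exact: (continuousM cc (cd x)).
have g_le0 x : g x <= 0 by rewrite /g mulNr oppr_le0 mulr_ge0 ?cdist_ge0// ltW.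
have g0 x : bdry D x -> g x = 0 by move=> bx; rewrite /g /d cdist_in// mulr0.
have [u [pu ug] ub] := boundary_minorant bD (P_hyperconvex_supp_bdry hD) cg g0 e0.
exists (fun x => Num.max 0 (1 + u x)); split.
- apply: psho_max; first exact: psho_cst.
  by apply: psho_add; [exact: psho_cst|exact: psho_sub pu].
- move=> x Yx; rewrite le_max lexx /= ge_max ler01 /=.
  by have := ug x (YD x Yx); have := g_le0 x; lra.
- move=> x Yx nWx; apply/max_idPl.
  have Kx : K x by [].
  have : 1 <= c^-1 * d x by rewrite mulrC ler_pdivlMr// mul1r dc.
  by have := ug x (YD x Yx); rewrite /g mulNr; lra.
- move=> x Yx Fx; rewrite le_max; apply/orP; right.
  by have := ub x (YF x Yx Fx); lra.
Qed.

(** Adding bumps supported in smaller and smaller neighbourhoods of [F] yields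
    functions which grow at [F] while staying comparable with each other: outside
    the last neighbourhood the new bumps vanish, and inside it all the old
    functions are already close to their maximum. *)
Lemma bump_ladder (l : seq T) (Y : T -> set T) F (W : set T) :
  (forall z, z \in l -> compact (Y z)) -> open W -> F `<=` W ->
  (forall z (O : set T) (e : R), z \in l -> open O -> F `<=` O -> 0 < e ->
    exists h : T -> R, [/\ psho (Y z) h, forall x, Y z x -> 0 <= h x <= 1,
    forall x, Y z x -> ~ O x -> h x = 0 & forall x, Y z x -> F x -> 1 - e <= h x]) ->
  forall N : nat, exists chi : T -> T -> R,
    [/\ forall z, z \in l -> psho (Y z) (chi z),
        forall z x, z \in l -> Y z x -> 0 <= chi z x <= N%:R,
        forall z x, z \in l -> Y z x -> ~ W x -> chi z x = 0,
        forall z x, z \in l -> Y z x -> F x -> N%:R - 1 + 2^-1 ^+ N <= chi z x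
      & forall z k x, z \in l -> k \in l -> Y z x -> Y k x ->
          chi z x <= chi k x + 2].
Proof.
move=> cY oW FW bump; elim=> [|N [chi [pc c0N cW cF cc]]].
  exists (fun _ _ => 0); split=> //.
  - by move=> z _; exact: psho_cst.
  - by move=> *; rewrite lexx.
  - by move=> *; rewrite expr0; lra.
(* On [O] all the functions built so far are within 1 of their upper bound. *)
pose O : set T := interior [set y | W y /\
  forall z, z \in l -> Y z y -> N%:R - 1 < chi z y].
have oO : open O by exact: open_interior.
have OP y : O y -> W y /\ forall z, z \in l -> Y z y -> N%:R - 1 < chi z y.
  by move=> /interior_subset.
have p0 m : 0 < 2^-1 ^+ m :> R by rewrite exprn_gt0// invr_gt0.
have FO : F `<=` O.
  move=> x Fx; suff h : nbhs x (W `&` [set y | forall z, z \in l -> Y z y -> N%:R - 1 < chi z y]).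
    exact: h.
  apply: filterI; first exact: open_nbhs_nbhs (conj oW (FW x Fx)).
  apply: near_seq => z zl.
  have [V oV Vc] := continuous_gt_open (N%:R - 1) (psho_within (pc z zl)).
  have [Yx|nYx] := pselect (Y z x).
    have Vx : V x by apply/(Vc x Yx); have := cF z x zl Yx Fx; have := p0 N; lra.
    by apply: filterS (open_nbhs_nbhs (conj oV Vx)) => y Vy Yy; exact/(Vc y Yy).
  have oY : open (~` Y z) by exact: closed_openC (compact_closed_Cn (cY z zl)).
  by apply: filterS (open_nbhs_nbhs (conj oY nYx)) => y nYy /nYy.
have pick z : exists h : T -> R, z \in l -> [/\ psho (Y z) h,
    forall x, Y z x -> 0 <= h x <= 1, forall x, Y z x -> ~ O x -> h x = 0
    & forall x, Y z x -> F x -> 1 - 2^-1 ^+ N.+1 <= h x].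
  have [zl|zl] := boolP (z \in l); last by exists (fun=> 0).
  by have [h hP] := bump z O _ zl oO FO (p0 N.+1); exists h.
have [h hP] := choice pick.
exists (fun z x => chi z x + h z x); split.
- by move=> z zl; apply: psho_add; [exact: pc|case: (hP z zl)].
- move=> z x zl Yx; have [_ h01 _ _] := hP z zl.
  have /andP[h0 h1] := h01 x Yx; have /andP[ch0 ch1] := c0N z x zl Yx.
  by rewrite addr_ge0//= -natr1 lerD.
- move=> z x zl Yx nWx; have [_ _ hO _] := hP z zl.
  by rewrite cW// hO ?addr0// => /OP[].
- move=> z x zl Yx Fx; have [_ _ _ hF] := hP z zl.
  have := hF x Yx Fx; have := cF z x zl Yx Fx.
  by rewrite exprS -[N.+1%:R]natr1; move: (_ ^+ N) => p; lra.
move=> z k x zl kl Yz Yk.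
have [_ hz hzO _] := hP z zl; have [_ hk hkO _] := hP k kl.
have [Ox|nOx] := pselect (O x); last by rewrite hzO// hkO// !addr0 cc.
have /andP[_ hz1] := hz x Yz; have /andP[hk0 _] := hk x Yk.
have /andP[_ cz] := c0N z x zl Yz; have [_ /(_ k kl Yk) ck] := OP x Ox.
lra.
Qed.

Lemma cpsh_bigmax G (l : seq T) (P : pred T) (f : T -> T -> R) (a : R) : open G ->
  (forall z, z \in l -> P z -> cpsh G (f z)) ->
  cpsh G (fun y => \big[Num.max/a]_(z <- l | P z) f z y).
Proof.
move=> oG; elim: l => [_|z l IH lf].
  have -> : (fun y => \big[Num.max/a]_(z <- [::] | P z) f z y) = (fun=> a).
    by apply/funext => y; rewrite big_nil.
  exact: cpsh_cst.
have {}IH := IH (fun k kl => lf k (mem_behead (s := z :: l) kl)).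
have [Pz|nPz] := boolP (P z).
  have -> : (fun y => \big[Num.max/a]_(k <- z :: l | P k) f k y) =
      (fun y => Num.max (f z y) (\big[Num.max/a]_(k <- l | P k) f k y)).
    by apply/funext => y; rewrite big_cons Pz.
  by apply: cpsh_max => //; apply: lf => //; exact: mem_head.
have -> : (fun y => \big[Num.max/a]_(k <- z :: l | P k) f k y) =
    (fun y => \big[Num.max/a]_(k <- l | P k) f k y).
  by apply/funext => y; rewrite big_cons (negbTE nPz).
exact: IH.
Qed.

(** A maximum of functions defined on balls is plurisubharmonic when on the
    boundary of each ball the corresponding function is strictly smaller than
    another term. *)
Lemma psho_glue_max X (l : seq T) (s : T -> R) (f : T -> T -> R) (a : R) :
  (forall z, z \in l -> psho (X `&` [set x | rnorm (x - z) <= s z]) (f z)) ->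
  (forall z x, z \in l -> X x -> rnorm (x - z) = s z -> f z x < a \/
    exists k, [/\ k \in l, rnorm (x - k) < s k & f z x < f k x]) ->
  psho X (fun x => \big[Num.max/a]_(z <- l | rnorm (x - z) < s z) f z x).
Proof.
move=> pf edge.
have pick z : exists UV : set T * (T -> R), z \in l -> [/\ cpsh UV.1 UV.2,
    forall x, X x -> rnorm (x - z) <= s z -> UV.1 x
    & forall x, X x -> rnorm (x - z) <= s z -> UV.2 x = f z x].
  have [zl|zl] := boolP (z \in l); last by exists (set0, fun=> 0).
  have /pshoP[U [v [pv YU vf]]] := pf z zl.
  by exists (U, v) => _; split=> // x Xx xz; [apply: YU|apply: vf].
have [E EP] := choice pick.
pose U z := (E z).1; pose ext z := (E z).2.
pose V x := \big[Num.max/a]_(z <- l | rnorm (x - z) < s z) ext z x.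
have cr z : continuous (fun y : T => rnorm (y - z)).
  move=> y; apply: (@continuous_comp _ _ _ (fun y : T => y - z) (@rnorm R T)).
    by apply: (@continuous_rnormD R T T) => p q; rewrite opprD addrACA subrr addr0.
  exact: rnorm_continuous.
have near_lt z x (r : R) : rnorm (x - z) < r -> nbhs x [set y | rnorm (y - z) < r].
  move=> xr; apply: open_nbhs_nbhs; split=> //.
  by move/continuousP: (cr z) => /(_ _ (@open_lt R r)).
have near_gt z x (r : R) : r < rnorm (x - z) -> nbhs x [set y | r < rnorm (y - z)].
  move=> xr; apply: open_nbhs_nbhs; split=> //.
  by move/continuousP: (cr z) => /(_ _ (@open_gt R r)).
have pV : psho X V.
  apply: psho_local => x Xx.
  pose act z := rnorm (x - z) < s z.
  pose w y := \big[Num.max/a]_(z <- l | act z) ext z y.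
  (* Near [x] the terms with [rnorm (x - z) < s z] remain, those with
   [rnorm (x - z) > s z] do not appear, and the others are not maximal. *)
pose Q z y : Prop := if act z then U z y /\ rnorm (y - z) < s z
    else rnorm (y - z) < s z -> ext z y <= w y.
  have nQ : nbhs x [set y | forall z, z \in l -> Q z y].
    apply: near_seq => z zl; have [pz Uz ez] := EP z zl.
    rewrite /Q; have [xz|xz|xz] := ltgtP (rnorm (x - z)) (s z).
    - rewrite /act xz; apply: filterI; last exact: near_lt.
      by have [oU _ _] := pz; apply: open_nbhs_nbhs; split=> //; apply: Uz => //; exact: ltW.
    - rewrite /act ltNge ltW//=; apply: filterS (near_gt _ _ _ xz) => y /= yz.
      by rewrite ltNge (ltW yz).
    rewrite /act xz ltxx; have xz' : rnorm (x - z) <= s z by rewrite xz.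
    have Ux := Uz x Xx xz'.
    have [fa|[k [kl xk fk]]] := edge z x zl Xx xz.
      have pa : cpsh setT (fun _ : T => a) by apply: cpsh_cst; exact: openT.
      have oG := cpsh_lt_open pz pa.
      have Gx : [/\ U z x, setT x & ext z x < a] by split=> //; rewrite /ext ez.
      apply: filterS (open_nbhs_nbhs (conj oG Gx)) => y [_ _ ya] _.
      by rewrite (le_trans (ltW ya))// /w bigmax_idl le_max lexx.
    have [pk Uk ek] := EP k kl.
    have oG := cpsh_lt_open pz pk.
    have Gx : [/\ U z x, U k x & ext z x < ext k x].
      by split=> //; [apply: Uk => //; exact: ltW|rewrite /ext ez// ek// ltW].
    apply: filterS (open_nbhs_nbhs (conj oG Gx)) => y [_ _ yk] _.
    by rewrite (le_trans (ltW yk))// /w; apply: (le_bigmax_seq _ k).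
  exists (interior [set y | forall z, z \in l -> Q z y]), w; split=> //.
    apply: cpsh_bigmax => [|z zl xz]; first exact: open_interior.
    have [pz _ _] := EP z zl; apply: cpsh_sub pz; first exact: open_interior.
    by move=> y /interior_subset/(_ z zl); rewrite /Q xz => -[].
  move=> y /interior_subset yQ; apply/le_anti/andP; split.
    rewrite /V big_seq_cond; apply: bigmax_le => [|z /andP[zl yz]].
      by rewrite /w bigmax_idl le_max lexx.
    have := yQ z zl; rewrite /Q; case: ifPn => [xz _|_]; last exact.
    exact: (le_bigmax_seq _ z).
  rewrite /w big_seq_cond; apply: bigmax_le => [|z /andP[zl xz]].
    by rewrite /V bigmax_idl le_max lexx.
  by have := yQ z zl; rewrite /Q xz => -[_ yz]; exact: (le_bigmax_seq _ z).
have /pshoP[W [v [pv XW vV]]] := pV; apply/pshoP; exists W, v; split=> // x Xx.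
rewrite vV// /V big_seq_cond [RHS]big_seq_cond; apply: eq_bigr => z /andP[zl xz].
by have [_ _ ez] := EP z zl; rewrite /ext ez// ltW.
Qed.

End localization.

(** * From local to global *)

Section local_to_global.
Variables (R : realType) (n : nat).
Local Notation T := (Cn R n).
Local Notation B := (BorelCn R n).
Implicit Types (X Y K D U F O V : set T) (mu : probability B R) (u v w g h : T -> R) (x y z k : T).

Lemma open_rball z (r : R) : open [set x : T | rnorm (x - z) < r].
Proof.
rewrite openE => x /= xr; apply/(@nbhs_rnormP R T).
exists (r - rnorm (x - z)); first by rewrite subr_gt0.
move=> y yx /=; have := ler_rdistD x y z.
by lra.
Qed.

(** Around each boundary point [z] the closed ball of radius [s z] is well inside
    a neighbourhood [V] with [V `&` D] P-hyperconvex. In that ball the closures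
    of [D] and of [V `&` D] agree, and so do their boundaries. *)
Lemma local_bumps D : bounded_domain D ->
  (forall z, closure D z -> exists V, nbhs z V /\ P_hyperconvex (V `&` D)) ->
  exists s : T -> R, (forall z, 0 < s z) /\
    forall z O (e : R), bdry D z -> open O -> bdry D `<=` O -> 0 < e ->
    exists h, let Y := closure D `&` [set x | rnorm (x - z) <= s z] in
    [/\ psho Y h, forall x, Y x -> 0 <= h x <= 1, forall x, Y x -> ~ O x -> h x = 0
      & forall x, Y x -> bdry D x -> 1 - e <= h x].
Proof.
move=> bD loc; have [oD _ _ bbD] := bD; have cX := bounded_closure_compact bbD.
(* The factor 2 keeps a neighbourhood of the closed ball inside [V]. *)
have pick z : exists sV : R * set T, 0 < sV.1 /\ (bdry D z ->
    P_hyperconvex (sV.2 `&` D) /\ forall x, rnorm (x - z) < 2 * sV.1 -> sV.2 x).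
  have [bz|nbz] := pselect (bdry D z); last by exists (1, set0); split.
  have Xz : closure D z by case: bz.
  have [V [/nbhs_rnormP[r r0 rV] hV]] := loc z Xz.
  exists (r / 2, V); split=> /= [|_]; first by rewrite divr_gt0.
  by split=> // x; rewrite mulrC divfK// => /rV.
have [sV sVP] := choice pick.
exists (fun z => (sV z).1); split=> [z|z O e bz oO bO e0]; first by case: (sVP z).
have [s0 /(_ bz)[hV Vs]] := sVP z; set s := (sV z).1 in s0 Vs *; set V := (sV z).2 in hV Vs.
set Y := closure D `&` _.
have Vlt x : Y x -> exists2 r : R, 0 < r & forall y, rnorm (y - x) < r -> V y.
  move=> [_ /= xs]; exists s => // y yx; apply: Vs.
  by have := ler_rdistD x y z; lra.
have [[oVD _ _ _] _] := hV.
have YV : Y `<=` closure (V `&` D).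
  move=> x Yx A xA; have [r r0 rV] := Vlt x Yx.
  have nV : nbhs x V by apply/(@nbhs_rnormP R T); exists r.
  have [t [Dt [At Vt]]] := Yx.1 _ (filterI xA nV).
  by exists t.
have YVx x : Y x -> V x.
  by move=> Yx; have [r r0] := Vlt x Yx; apply; rewrite subrr rnorm0.
have cY : compact Y by apply: compact_closedI => //; exact: closed_rball.
apply: (local_bump hV cY YV _ _ oO bO e0) => x Yx.
  move=> nbx; split; first exact: YVx.
  by apply: contrapT => nDx; apply: nbx; apply/(bdryP _ oD); case: Yx.
move=> /(bdryP _ oD)[_ nDx]; apply/(bdryP _ oVD); split; first exact: YV.
by case.
Qed.

(** Bumps near the boundary points, stacked up by [bump_ladder], are glued after
    the addition of bounded quadratic terms that favour, at each point, the balls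
    centred nearby. The functions obtained grow at the boundary and stay bounded
    on a given compact subset of the domain. *)
Lemma growing_functions D K : (0 < n)%N -> bounded_domain D ->
  (forall z, closure D z -> exists V, nbhs z V /\ P_hyperconvex (V `&` D)) ->
  compact K -> K `<=` D ->
  exists2 C : R, 0 < C & forall N : nat, exists v, [/\ psho (closure D) v,
    forall x, closure D x -> v x <= N%:R + C, forall x, bdry D x -> N%:R - C <= v x
    & forall x, K x -> v x <= C].
Proof.
move=> n0 bD loc cK KD; have [oD _ _ bbD] := bD.
have cX := bounded_closure_compact bbD; have cb := bdry_compact oD cX.
have [s [s0 bump]] := local_bumps bD loc.
(* The balls of radius [r z] cover the boundary. They are so small, compared to
   the balls of radius [s z], that the Euclidean norm separates the two. *)
pose r z : R := s z / (2 * n%:R).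
have n1 : 1 <= n%:R :> R by rewrite ler1n.
have r0 z : 0 < r z by rewrite divr_gt0// mulr_gt0// ltr0n.
have rs z : r z < s z.
  by rewrite ltr_pdivrMr ?mulr_gt0 ?ltr0n// ltr_pMr//; lra.
have cov : bdry D `<=` cover (bdry D) (fun z => [set x | rnorm (x - z) < r z]).
  by move=> z bz; exists z => //=; rewrite subrr rnorm0.
have := cb; rewrite compact_cover => /(_ _ _ _ (fun z _ => @open_rball z (r z)) cov).
move=> [D' D'b bD']; pose l : seq T := enum_fset D'.
have lb z : z \in l -> bdry D z by move=> /D'b; rewrite inE.
have bl x : bdry D x -> exists2 z, z \in l & rnorm (x - z) < r z.
  by move=> /bD'[z zD' xz]; exists z.
(* The bumps are to be supported near the boundary and away from [K]. *)
pose W := [set x | exists2 z, z \in l & rnorm (x - z) < r z] `&` ~` K.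
have oW : open W.
  apply: openI; last exact: closed_openC (compact_closed_Cn cK).
  rewrite (_ : [set x | _] = \bigcup_(z in [set` l]) [set x | rnorm (x - z) < r z]).
    by apply: bigcup_open => z _; exact: open_rball.
  by apply/seteqP; split=> x [z zl xz]; exists z.
have bW : bdry D `<=` W.
  by move=> x bx; split; [exact: bl|move=> /KD; case/(bdryP _ oD): bx].
pose Y z := closure D `&` [set x | rnorm (x - z) <= s z].
have cY z : z \in l -> compact (Y z).
  by move=> _; apply: compact_closedI => //; exact: closed_rball.
have ladder := bump_ladder cY oW bW (fun z O e zl => bump z O e (lb z zl)).
(* The weights are such that [A z * sqnorm (x - z)] is at most 1 if
   [rnorm (x - z) < r z], and at least 4 if [rnorm (x - z) = s z]. The gap
   beats the discrepancy 2 between the functions of the ladder. *)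
pose A z : R := 4 / s z ^+ 2.
pose M : R := \big[Num.max/0]_(z <- l) A z.
have A0 z : 0 <= A z by rewrite divr_ge0// exprn_ge0// ltW.
have AM z : z \in l -> A z <= M by move=> zl; apply: (le_bigmax_seq _ z).
have M0 : 0 <= M by rewrite /M bigmax_idl le_max lexx.
pose q z x : R := M * sqnorm x - A z * sqnorm (x - z).
have pq z : z \in l -> cpsh setT (q z).
  by move=> zl; apply: cpsh_quadratic; rewrite A0 AM.
have [L L0 sqL] := compact_bound cX (continuous_subspaceT (@sqnorm_continuous R n)).
have q_le z x : closure D x -> q z x <= M * L.
  move=> /sqL; rewrite ger0_norm ?sqnorm_ge0// => xL.
  have : 0 <= A z * sqnorm (x - z) by rewrite mulr_ge0 ?sqnorm_ge0.
  have : M * sqnorm x <= M * L by rewrite ler_wpM2l.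
  by rewrite /q; lra.
have q_near z x : rnorm (x - z) < r z -> M * sqnorm x - 1 <= q z x.
  move=> xz; rewrite lerB// mulrC mulrA ler_pdivrMr ?exprn_gt0// mul1r.
  have : rnorm (x - z) ^+ 2 <= r z ^+ 2.
    by rewrite ler_sqr ?nnegrE ?rnorm_ge0// ltW.
  have := sqnorm_le (x - z).
  have -> : s z ^+ 2 = n%:R * (r z ^+ 2) * 4 * n%:R.
    by rewrite /r; field; rewrite gt_eqF ?ltr0n.
  set t := sqnorm _; set p := r z ^+ 2; set c := rnorm _ ^+ 2 => tc cp.
  have : n%:R * c <= n%:R * p by rewrite ler_wpM2l.
  have p0 : 0 <= p by exact: sqr_ge0.
  have : n%:R * p * 4 * 1 <= n%:R * p * 4 * n%:R.
    by apply: ler_wpM2l => //; rewrite mulr_ge0// mulr_ge0.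
  by lra.
have q_far z x : rnorm (x - z) = s z -> q z x <= M * sqnorm x - 4.
  move=> xz; rewrite lerB//; have sz : s z ^+ 2 != 0 by rewrite expf_neq0// gt_eqF.
  have := ler_wpM2l (A0 z) (sqnorm_ge (x - z)).
  by rewrite xz {1}/A divfK.
(* Off [W] the functions to be glued are smaller than [a]. *)
pose a := M * L + 1.
have ML0 : 0 <= M * L by rewrite mulr_ge0// ltW.
exists (M * L + 2) => [|N]; first by lra.
have [chi [pc c0N cW cF cc]] := ladder N.
pose f z x := chi z x + q z x.
have N0 : 0 <= N%:R :> R by [].
exists (fun x => \big[Num.max/a]_(z <- l | rnorm (x - z) < s z) f z x); split.
- apply: psho_glue_max => [z zl|z x zl Xx xz].
    apply: psho_add; first exact: pc.
    by apply/pshoP; exists setT, (q z); split=> //; exact: pq.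
  have Yzx : Y z x by split=> //=; rewrite xz.
  have [[[k kl xk] _]|nWx] := pselect (W x); last first.
    by left; rewrite /f (cW z x zl Yzx nWx) add0r /a; have := q_le z x Xx; lra.
  right; exists k; have xk' := lt_trans xk (rs k).
  split=> //; have Ykx : Y k x by split=> //=; exact: ltW.
  have := cc z k x zl kl Yzx Ykx; have := q_near k x xk; have := q_far z x xz.
  by rewrite /f; lra.
- move=> x Xx; rewrite big_seq_cond; apply: bigmax_le => [|z /andP[zl xz]].
    by rewrite /a; lra.
  have Yzx : Y z x by split=> //=; exact: ltW.
  have /andP[_ h1] := c0N z x zl Yzx; have := q_le z x Xx.
  by rewrite /f; lra.
- move=> x bx; have [z zl xz] := bl x bx; have xz' := lt_trans xz (rs z).
  have Xx : closure D x by case: bx.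
  have Yzx : Y z x by split=> //=; exact: ltW.
  have fx : N%:R - (M * L + 2) <= f z x.
    have := cF z x zl Yzx bx; have := q_near z x xz.
    have : 0 <= 2^-1 ^+ N :> R by rewrite exprn_ge0// invr_ge0.
    have : 0 <= M * sqnorm x by rewrite mulr_ge0 ?sqnorm_ge0.
    by rewrite /f; lra.
  by apply: le_trans fx _; apply: (le_bigmax_seq _ z).
- move=> x Kx; rewrite big_seq_cond; apply: bigmax_le => [|z /andP[zl xz]].
    by rewrite /a; lra.
  have Xx : closure D x by exact/subset_closure/KD.
  have Yzx : Y z x by split=> //=; exact: ltW.
  have nWx : ~ W x by case.
  by rewrite /f (cW z x zl Yzx nWx) add0r; have := q_le z x Xx; lra.
Qed.

(** The integral of [a - v] is at least its integral over [K]. *)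
Lemma jensen_mass X K z mu v (a b : R) : compact X -> jensen X z mu -> psho X v ->
  measurable (K : set B) -> K `<=` X -> (forall x, X x -> v x <= a) ->
  (forall x, K x -> v x <= b) -> b <= a ->
  v z <= a - (a - b) * fine (mu K).
Proof.
move=> cX [muX Jmu] pv mK KX va vb ba; have mX := compact_borel cX.
have cv := psho_within pv.
have int := within_integrable mu cX cv.
have cc : {within X, continuous (fun _ : T => a)}.
  by apply: continuous_subspaceT; exact: cst_continuous.
have intc := within_integrable mu cX cc.
have fK : mu K \is a fin_num by exact: fin_num_measure.
have ev : (\int[mu]_(x in X) (a - v x)%:E = a%:E - \int[mu]_(x in X) (v x)%:E)%E.
  have -> : (\int[mu]_(x in X) (a - v x)%:E = \int[mu]_(x in X) (a%:E - (v x)%:E))%E by [].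
  rewrite (@integralB_EFin _ _ _ mu _ (fun=> a) v mX intc int); congr (_ - _)%E.
  by rewrite integral_cst//; rewrite [Z in (_ * Z)%E]muX mule1.
have cw : {within X, continuous (fun x => a - v x)} by move=> x; exact: (continuousB (cc x) (cv x)).
have mw : measurable_fun (X : set B) (fun x => (a - v x)%:E).
  by apply/measurable_EFinP; exact: within_measurable mX cw.
have w0 x : X x -> (0 <= (a - v x)%:E)%E by move=> Xx; rewrite lee_fin subr_ge0 va.
have : ((a - b)%:E * mu K <= \int[mu]_(x in X) (a - v x)%:E)%E.
  rewrite -integral_cst//; apply: le_trans (ge0_subset_integral mu mK mX mw w0 KX).
  apply: ge0_le_integral => //.
  - by move=> x _; rewrite lee_fin subr_ge0.
  - exact: (measurable_funS mX KX mw).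
  - by move=> x Kx; rewrite lee_fin lerB// vb.
have := Jmu v pv.
have fv := integrable_fin_num mX int.
rewrite ev -(fineK fK) -(fineK fv) -EFinM -EFinB !lee_fin.
by lra.
Qed.

(** If a Jensen measure for a boundary point charges a compact subset [K] of the
    domain, the functions growing at the boundary violate the inequality that
    defines Jensen measures: their value at the point is at least [N - C] whereas
    their integral is at most [N + C] minus [N] times the mass of [K]. *)
Lemma local_P_hyperconvex_supp_bdry D : (0 < n)%N -> bounded_domain D ->
  (forall z, closure D z -> exists V, nbhs z V /\ P_hyperconvex (V `&` D)) ->
  jensen_supp_bdry D.
Proof.
move=> n0 bD loc z mu bz Jmu y sy; have [oD _ _ bbD] := bD.
have cX := bounded_closure_compact bbD.
have Xy := supp_sub (compact_closed_Cn cX) Jmu.1 sy.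
apply/(bdryP _ oD); split=> // Dy.
have /nbhs_rnormP[r r0 rD] := open_nbhs_nbhs (conj oD Dy).
pose K := [set x : T | rnorm (x - y) <= r / 2].
have KD : K `<=` D by move=> x /= Kx; apply: rD; apply: le_lt_trans Kx _; rewrite ltr_pdivrMr// ltr_pMr// ltr1n.
have KX : K `<=` closure D by move=> x /KD; exact: subset_closure.
have clK : closed K by exact: closed_rball.
have cK : compact K by exact: subclosed_compact clK cX KX.
have mK := closed_borel clK.
have muK : (0 < mu K)%E.
  have oU := @open_rball y (r / 2).
  apply: lt_le_trans (sy _ oU _) _; first by rewrite /= subrr rnorm0 divr_gt0.
  apply: le_measure; rewrite ?inE//; first exact: open_borel.
  by move=> x /ltW.
have m0 : 0 < fine (mu K).
  by apply: fine_gt0; rewrite muK /= (le_lt_trans (probability_le1 mu mK))// ltry.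
have [C C0 grow] := growing_functions n0 bD loc cK KD.
pose m := fine (mu K).
have bound (N : nat) : N%:R * m <= 2 * C.
  have [v [pv vX vb vK]] := grow N.
  have le : C <= N%:R + C by rewrite lerDr.
  have := jensen_mass cX Jmu pv mK KX vX vK le; rewrite addrK -/m.
  by have := vb z bz; lra.
have := bound (Num.truncn (2 * C / m)).+1; rewrite leNgt -ltr_pdivrMr//.
by rewrite truncnS_gt.
Qed.

End local_to_global.

Local Open Scope ereal_scope.

Theorem theorem1 (R : realType) (n : nat) (hn : (0 < n)%N)
    (Omega : set (Cn R n)) (hOmega : bounded_domain Omega) :
  [<-> P_hyperconvex Omega;
       forall (z : Cn R n) (mu : probability (BorelCn R n) R),
         bdry Omega z -> jensen (closure Omega) z mu ->
         supp mu `<=` bdry Omega;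
       forall z : Cn R n, bdry Omega z ->
         exists phi : Cn R n -> \bar R,
           [/\ psh_compact (closure Omega) phi,
               exists x, closure Omega x /\ phi x != 0,
               forall x, closure Omega x -> phi x <= 0
             & phi z = 0];
       forall z : Cn R n, closure Omega z ->
         exists V : set (Cn R n), nbhs z V /\ P_hyperconvex (V `&` Omega)].
Proof.
tfae.
- exact: P_hyperconvex_supp_bdry.
- move=> supp_bdry z bz; exists (fun x => if x \in Omega then -1 else 0)%E.
  split.
  + exact: supp_bdry_barrier.
  + have [_ _ [x Ox] _] := hOmega; exists x; split; first exact: subset_closure.
    by rewrite mem_set// eqe oppr_eq0 oner_eq0.
  + by move=> x _; case: ifP => // _; rewrite lee_fin oppr_le0.
  + have [oO _ _ _] := hOmega; have [_ nOz] := (bdryP z oO).1 bz.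
    by rewrite memNset.
- move=> barrier z _; exists setT; split; first exact: filterT.
  rewrite setTI; apply: jensen_supp_bdry_P_hyperconvex => // x mu bx Jmu.
  have [phi [pphi phi1 phi0 phix]] := barrier x bx.
  exact: (barrier_supp_bdry hOmega pphi phi1 phi0 phix bx Jmu).
- move=> loc; apply: jensen_supp_bdry_P_hyperconvex => //.
  exact: local_P_hyperconvex_supp_bdry.
Qed.
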